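(* Let $E$ be a nonzero $\mathbb{Z}^n$-graded, finitely generated, reflexive $S$-module with underlying vector space arrangement $\mathcal{V}_E$, and let $X\mapsto \underline{i}^X$ be the embedding of the poset $\mathcal{V}_E$ into $\mathbb{Z}^n$. Then the poset of nonzero graded Betti numbers of $E$ is determined by this embedding of $\mathcal{V}_E$ into $\mathbb{Z}^n$, and for given $X\in\mathcal{V}_E$ the corresponding Betti number depends only on $\mathcal{V}_E$. Explicitly: (1) if $\underline{c}\in\mathbb{Z}^n$ and $\beta_i(\underline{c})\neq 0$ for some $i\ge 0$, then $\underline{c}=\underline{i}^X$ for some $X\in\mathcal{V}_E$; (2) if $E'$ is a nonzero $\mathbb{Z}^{n'}$-graded finitely generated reflexive module over $S'=\mathbb{K}[x_1,\dots,x_{n'}]$ (for some $n'\geq 1$) with arrangement $\mathcal{V}_{E'}$ in $\mathbf{E}'$, and $\varphi:\mathbf{E}\to\mathbf{E}'$ is an isomorphism of vector spaces such that $X\mapsto\varphi(X)$ maps $\mathcal{V}_E$ bijectively onto $\mathcal{V}_{E'}$, then for all $i\ge 0$ and all $X\in\mathcal{V}_E$ the graded Betti number $\beta_i(\underline{i}^X)$ of $E$ equals the graded Betti number $\beta_i(\underline{i}^{\varphi(X)})$ of $E'$.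
   Context: $\mathbb{K}$ is a field and $S=\mathbb{K}[x_1,\dots,x_n]$ ($n\ge 1$) carries its standard $\mathbb{Z}^n$-grading; $[n]=\{1,\dots,n\}$. $\mathbb{Z}^n$ is ordered componentwise. $E(\underline{a})_{\underline{b}}=E_{\underline{a}+\underline{b}}$. Finitely generated $\mathbb{Z}^n$-graded reflexive $S$-modules $E$ correspond (Klyachko) to finite-dimensional vector spaces $\mathbf{E}$ with $n$ increasing filtrations $\cdots\subseteq E^k(i)\subseteq E^k(i+1)\subseteq\cdots\subseteq\mathbf{E}$, $k\in[n]$, with $E^k(i)=0$ for $i\ll 0$ and $E^k(i)=\mathbf{E}$ for $i\gg 0$. Here $\mathbf{E}$ is the colimit of the graded components $E_{\underline{c}}$ under multiplication by monomials, and under the injections $E_{\underline{c}}\hookrightarrow\mathbf{E}$ one has $E_{\underline{c}}=\bigcap_{k}E^k(c_k)$ for $\underline{c}=(c_1,\dots,c_n)\in\mathbb{Z}^n$. For each $k$ let $i^k_1<\cdots<i^k_{t_k}$ be the integers $i$ with $E^k(i-1)\subsetneq E^k(i)$. $\mathcal{V}_E$ is the set of all intersections of the subspaces $E^k(i^k_j)$ ($k\in[n]$, $1\le j\le t_k$), partially ordered by inclusion. The embedding into $\mathbb{Z}^n$ is $X\mapsto\underline{i}^X=(i^X_1,\dots,i^X_n)$ with $i^X_k=\min\{i^k_j\mid X\subseteq E^k(i^k_j)\}$. The graded Betti numbers $\beta_i(\underline{c})$ are defined by the minimal $\mathbb{Z}^n$-graded free resolution $\cdots\to F_1\to F_0\to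 E\to 0$ with $F_i\cong\bigoplus_{\underline{c}}S(-\underline{c})^{\beta_i(\underline{c})}$. The poset of nonzero graded Betti numbers is the set of $\underline{c}$ with some $\beta_i(\underline{c})\ne 0$, with the order induced from $\mathbb{Z}^n$. *)

(* Defs.v *)
From HB Require Import structures.
From Stdlib Require Import ClassicalEpsilon.
From mathcomp Require Import all_boot all_order all_algebra.
From mathcomp.multinomials Require Import mpoly.
From mathcomp Require Import zify.

Set Implicit Arguments.
Unset Strict Implicit.
Unset Printing Implicit Defensive.

Import Order.TTheory GRing.Theory Num.Theory.
Local Open Scope ring_scope.

Section Degrees.
Variables (K : fieldType) (n : nat).

Definition degree := {ffun 'I_n -> int}.

Definition mdegree (m : 'X_{1..n}) : degree := [ffun k => (m k)%:Z].

(* p \in S_b for the Z^n-grading of S = {mpoly K[n]}; as distinct monomials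
   have distinct degrees, S_b is spanned by at most one monomial, and is 0
   when b has a negative coordinate. *)
Definition mpoly_homog (b : degree) (p : {mpoly K[n]}) : Prop :=
  forall m, m \in msupp p -> mdegree m = b.

End Degrees.

(* A Z^n-graded S-module: [ghomog c] is the graded component of degree c, and
   the last two axioms say that the module is the direct sum of its
   components. *)
Record gmodule (K : fieldType) (n : nat) := GModule {
  gcarrier :> lmodType {mpoly K[n]};
  ghomog : degree n -> gcarrier -> Prop;
  ghomog0 : forall c, ghomog c 0;
  ghomogD : forall c u v, ghomog c u -> ghomog c v -> ghomog c (u + v);
  ghomogM : forall b c p u,
    mpoly_homog b p -> ghomog c u -> ghomog (b + c) (p *: u);
  ghomog_sum : forall u, exists (s : seq (degree n)) (h : degree n -> gcarrier),
    (forall c, ghomog c (h c)) /\ u = \sum_(c <- s) h c;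
  ghomog_indep : forall (s : seq (degree n)) (h : degree n -> gcarrier),
    uniq s -> (forall c, ghomog c (h c)) -> \sum_(c <- s) h c = 0 ->
    forall c, c \in s -> h c = 0
}.

Definition finitely_generated (R : comNzRingType) (M : lmodType R) : Prop :=
  exists s : seq M, forall u : M, exists a : nat -> R,
    u = \sum_(i < size s) a i *: s`_i.

(* The biduality map M -> M^** is injective and surjective.  An element of
   M^** is a function theta on the linear forms that respects pointwise linear
   combinations; using =1 here also makes theta extensional (take a = 1 and
   g =1 0). *)
Definition reflexive_module (R : comNzRingType) (M : lmodType R) : Prop :=
  (forall u : M, (forall f : {linear M -> R^o}, f u = 0) -> u = 0) /\
  (forall theta : {linear M -> R^o} -> R,
     (forall (a : R) (f g h : {linear M -> R^o}),
        (h =1 fun u => a * f u + g u) -> theta h = a * theta f + theta g) ->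
     exists u : M, forall f : {linear M -> R^o}, theta f = f u).

Lemma vspace_of_closed (K : fieldType) (V : vectType K) (P : V -> Prop) :
  P 0 -> (forall (a : K) u v, P u -> P v -> P (a *: u + v)) ->
  exists U : {vspace V}, forall v, v \in U <-> P v.
Proof.
move=> P0 PD.
suff H m (U : {vspace V}) : (\dim {:V} - \dim U <= m)%N ->
    (forall v, v \in U -> P v) ->
    exists U : {vspace V}, forall v, v \in U <-> P v.
  by apply: (H _ 0%VS (leqnn _)) => v; rewrite memv0 => /eqP ->.
elim: m U => [|m IHm] U leUm UP;
  case: (classic (exists v, P v /\ v \notin U)) => [[v [Pv vU]]|noP];
  try by exists U => v; split=> [/UP//|Pv]; apply/negPn/negP => vU;
         apply: noP; exists v.
- case/negP: vU; suff /eqP -> : U == fullv by apply: memvf.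
  by rewrite eqEdim subvf -subn_eq0 -leqn0.
have ltU : (\dim U < \dim (U + <[v]>))%N.
  rewrite ltn_neqAle dimvS ?addvSl // andbT; apply/negP => /eqP eqd.
  have /eqP eqU : U == (U + <[v]>)%VS by rewrite eqEdim addvSl eqd leqnn.
  by case/negP: vU; rewrite eqU (subvP (addvSr U _)) // memv_line.
apply: (IHm (U + <[v]>)%VS).
  have := dimvS (subvf (U + <[v]>)%VS) => leV.
  rewrite -ltnS; apply: leq_trans leUm; apply: (ltn_sub2l _ ltU).
  exact: leq_trans ltU leV.
move=> x /memv_addP[u uU [w /vlineP[a ->] ->]].
by rewrite addrC; apply: PD => //; apply: UP.
Qed.

Section Arrangement.
Variables (K : fieldType) (n : nat) (E : gmodule K n).

(* A compatible family of K-linear maps psi c : E_c -> W, for the direct system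
   given by multiplication by monomials; the values of psi c outside E_c are
   irrelevant. *)
Definition cocone (W : lmodType K) (psi : degree n -> E -> W) : Prop :=
  (forall c (a : K) (u v : E), ghomog c u -> ghomog c v ->
     psi c (a%:MP *: u + v) = a *: psi c u + psi c v) /\
  (forall c (m : 'X_{1..n}) (u : E), ghomog c u ->
     psi (mdegree m + c) ('X_[m] *: u) = psi c u).

Definition is_colimit (V : lmodType K) (iota : degree n -> E -> V) : Prop :=
  cocone iota /\
  forall (W : lmodType K) (psi : degree n -> E -> W), cocone psi ->
    exists h : {linear V -> W},
      (forall c u, ghomog c u -> h (iota c u) = psi c u) /\
      (forall h' : {linear V -> W},
         (forall c u, ghomog c u -> h' (iota c u) = psi c u) -> h' =1 h).

Variables (V : vectType K) (iota : degree n -> E -> V).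

(* E^k(i) is the colimit of the components E_c with c_k = i, i.e. the union of
   their images in V; [klyachkoP] below shows that this union is a subspace. *)
Definition in_klyachko (k : 'I_n) (i : int) (v : V) : Prop :=
  exists (c : degree n) (u : E), [/\ c k = i, ghomog c u & v = iota c u].

Definition klyachko (k : 'I_n) (i : int) : {vspace V} :=
  epsilon (inhabits 0%VS) (fun U : {vspace V} =>
    forall v, v \in U <-> in_klyachko k i v).

Lemma klyachkoP (hiota : cocone iota) k i v :
  v \in klyachko k i <-> in_klyachko k i v.
Proof.
case: hiota => iotaD iotaM.
have iota0 c : iota c 0 = 0.
  have := iotaD c 1 0 0 (ghomog0 E c) (ghomog0 E c).
  rewrite scaler0 addr0 scale1r => h.
  by apply: (@addrI _ (iota c 0)); rewrite addr0.
have homX m c u : ghomog c u -> ghomog (mdegree m + c) ('X_[K, m] *: u : E).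
  by apply: ghomogM => m'; rewrite msuppX inE => /eqP ->.
have homC a c u : ghomog c u -> ghomog c (a%:MP *: u : E).
  move=> hu; rewrite -[c]add0r; apply: ghomogM hu => m.
  rewrite msuppC; case: ifP => // _; rewrite inE => /eqP ->.
  by apply/ffunP => j; rewrite !ffunE mnm0E.
apply: (epsilon_spec (inhabits 0%VS) (fun U : {vspace V} =>
  forall v, v \in U <-> in_klyachko k i v)).
apply: vspace_of_closed => [|a x y].
  by exists [ffun=> i], 0; rewrite ffunE; split=> //; apply: ghomog0.
case=> c [u [ck hu ->]] [d [w [dk hw ->]]].
pose m1 := [multinom `|Num.max (c j) (d j) - c j|%N | j < n].
pose m2 := [multinom `|Num.max (c j) (d j) - d j|%N | j < n].
have E1 : mdegree m1 + c = [ffun j => Num.max (c j) (d j)].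
  apply/ffunP => j; rewrite !ffunE mnmE gez0_abs ?subrK //.
  by rewrite subr_ge0 le_max lexx.
have E2 : mdegree m2 + d = [ffun j => Num.max (c j) (d j)].
  apply/ffunP => j; rewrite !ffunE mnmE gez0_abs ?subrK //.
  by rewrite subr_ge0 le_max lexx orbT.
have := homX m1 _ _ hu; have := homX m2 _ _ hw; rewrite E1 E2 => hw' hu'.
exists [ffun j => Num.max (c j) (d j)], (a%:MP *: ('X_[m1] *: u) + 'X_[m2] *: w).
split; first by rewrite ffunE ck dk maxxx.
  by apply: ghomogD => //; apply: homC.
rewrite iotaD // -(iotaM c m1) // -(iotaM d m2) //.
by rewrite E1 E2.
Qed.

Definition is_jump (k : 'I_n) (i : int) : Prop :=
  (klyachko k (i - 1) <= klyachko k i)%VS /\ klyachko k (i - 1) <> klyachko k i.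

(* The empty intersection is the whole space V; for E nonzero (and n >= 1) it
   is also E^k(i) for the largest jump i of any k, so allowing it adds
   nothing. *)
Definition arrangement (X : {vspace V}) : Prop :=
  exists s : seq ('I_n * int),
    (forall p, p \in s -> is_jump p.1 p.2) /\
    X = (\bigcap_(p <- s) klyachko p.1 p.2)%VS.

Definition minz (P : int -> Prop) : int :=
  epsilon (inhabits 0) (fun i => P i /\ forall j, P j -> i <= j).

Lemma minzP (P : int -> Prop) (b i : int) :
  (forall j, P j -> b <= j) -> P i ->
  P (minz P) /\ forall j, P j -> minz P <= j.
Proof.
move=> Pb Pi; apply: (epsilon_spec (inhabits 0)
  (fun i => P i /\ forall j, P j -> i <= j)).
have [m] : exists m, (`|i - b| <= m)%N by exists `|i - b|%N.
elim: m i Pi => [|m IHm] i Pi lem;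
  case: (classic (exists j, P j /\ j < i)) => [[j [Pj ltji]]|noj];
  try by exists i; split=> // j Pj; rewrite leNgt; apply/negP => ltji;
         apply: noj; exists j.
  by have := Pb j Pj; have := Pb i Pi; lia.
by apply: (IHm j Pj); have := Pb j Pj; have := Pb i Pi; lia.
Qed.

Definition embedding (X : {vspace V}) : degree n :=
  [ffun k => minz (fun i => is_jump k i /\ (X <= klyachko k i)%VS)].

End Arrangement.

Section Resolution.
Variables (K : fieldType) (n : nat).
Notation S := {mpoly K[n]}.

(* Homogeneous elements of degree c in the graded free module
   S(-d_1) + ... + S(-d_r), realised on row vectors. *)
Definition free_homog (r : nat) (d : 'I_r -> degree n) (c : degree n)
    (v : 'rV[S]_r) : Prop :=
  forall j, mpoly_homog (c - d j) (v 0 j).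

(* Minimal Z^n-graded free resolution ... -> F_1 -> F_0 -> E -> 0 with F_i of
   finite rank; minimality says that the image of F_(i+1) lies in m F_i, with
   m = (x_1, ..., x_n) the ideal of polynomials with zero constant term. *)
Record min_resolution (E : gmodule K n) := MinResolution {
  res_rank : nat -> nat;
  res_deg : forall i, 'I_(res_rank i) -> degree n;
  res_map : forall i,
    {linear 'rV[S]_(res_rank i.+1) -> 'rV[S]_(res_rank i)};
  res_aug : {linear 'rV[S]_(res_rank 0) -> E};
  res_map_homog : forall i c v,
    free_homog (@res_deg i.+1) c v -> free_homog (@res_deg i) c (res_map i v);
  res_aug_homog : forall c v,
    free_homog (@res_deg 0) c v -> ghomog c (res_aug v);
  res_aug_surj : forall u : E, exists v, res_aug v = u;
  res_exact0 : forall v, res_aug v = 0 <-> exists w, res_map 0 w = v;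
  res_exact : forall i v,
    res_map i v = 0 <-> exists w, res_map i.+1 w = v;
  res_minimal : forall i v j, (res_map i v 0 j)@_0%MM = 0
}.

Definition betti (E : gmodule K n) (F : min_resolution E) (i : nat)
    (c : degree n) : nat :=
  #|[set j : 'I_(res_rank F i) | res_deg j == c]|.

End Resolution.

Definition maps_bijectively (T U : Type) (f : T -> U) (A : T -> Prop)
    (B : U -> Prop) : Prop :=
  [/\ forall x, A x -> B (f x),
      forall x y, A x -> A y -> f x = f y -> x = y &
      forall y, B y -> exists2 x, A x & f x = y].

(* Main.v *)
Require Import Defs.
From Stdlib Require Import ClassicalEpsilon Permutation.
From HB Require Import structures.
From mathcomp Require Import all_boot all_order all_algebra.
From mathcomp.multinomials Require Import mpoly.
From mathcomp Require Import zify.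
Set Implicit Arguments.
Unset Strict Implicit.
Unset Printing Implicit Defensive.
Import Order.TTheory GRing.Theory Num.Theory.
Local Open Scope ring_scope.

(** The Betti number [betti F i c] is the dimension of Tor_i(E, K) in degree c,
    hence of the i-th homology of the Koszul complex of E in degree c, whose
    terms are the sums of the components E_(c - e_T) over the subsets T of [n]
    with i elements.  Reflexivity turns this complex into linear algebra inside
    the colimit V.  Writing W_c for the image of E_c in V, the maps E_c -> V are
    injective ([iota_eq0]) and W_c is the intersection of the E^k(c_k)
    ([componentP]: biduality divides an element by a monomial as soon as all
    linear forms allow it).  So multiplication by monomials becomes inclusion,
    and E_(c - e_T) becomes the intersection of W_c with the subspaces
    W_(c - e_k), k in T.  The Koszul complex in degree c is thus the complex
    [chain] attached to a space P = W_c and a list of subspaces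
    y_k = W_(c - e_k).

    The equality of Betti numbers with the dimension of Koszul homology
    ([betti_koszul_dim]) is obtained by dimension shifting along the resolution
    ([dim_shift], [dim_deg0]).  Setting all variables equal to 1 turns a free
    module into a power of K filtered by coordinate subspaces, so that modules,
    syzygies and free modules are all treated as filtered vector spaces, and
    their Koszul complexes as complexes of subspaces.

    Two facts on the complex of (P; y_1, ..., y_m) give the theorem.
    - If P is contained in some y_k, or P = 0, the complex is exact
      ([acyclic_sub], [acyclic_zero]): it is the cone of an isomorphism.
    - A member y_k whose trace on P is 0 or lies in another member can be
      dropped without changing the homology ([hdim_drop]), because the
      subcomplex it contributes is of the first kind.  Hence the homology is
      the same for two families that are cofinal in each other on P
      ([hdim_cofinal]).

    For part (1), a nonzero Betti number in degree c prevents X = W_c from being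
    contained in E^k(c_k - 1), for every k; so each c_k is a jump of the k-th
    filtration and the least one whose step contains X, that is, c = i^X.

    For part (2), let c = i^X with X nonzero.  Then W_c = X, and the traces of
    the W_(c - e_k) on X are proper subspaces of X that are 0 or belong to the
    arrangement, and every member of the arrangement strictly below X lies in
    one of them ([facet_arr], [facet_proper], [facet_cofinal]).  So they are
    cofinal among the members strictly below X, a set that the isomorphism
    transports; the numbers of variables need not agree.  For X = 0 both Betti
    numbers vanish. *)

(** * Subspaces and dimensions of subquotients *)

Section Subspace.
Variable K : fieldType.

(** Subspaces are predicates rather than [{vspace _}], so that the iterated
    products that hold Koszul chains need no more than a module structure. *)
Record subspace (A : lmodType K) := Subspace {
  in_subspace :> A -> Prop;
  sub0P : in_subspace 0;
  subLP : forall a u v, in_subspace u -> in_subspace v -> in_subspace (a *: u + v)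
}.

Section Closure.
Variables (A : lmodType K) (P : subspace A).

Lemma subD u v : P u -> P v -> P (u + v).
Proof. by move=> Pu Pv; rewrite -[u]scale1r; apply: subLP. Qed.

Lemma subZ a u : P u -> P (a *: u).
Proof. by move=> Pu; rewrite -[_ *: _]addr0; apply: subLP => //; apply: sub0P. Qed.

Lemma subN u : P u -> P (- u).
Proof. by rewrite -scaleN1r; apply: subZ. Qed.

Lemma subB u v : P u -> P v -> P (u - v).
Proof. by move=> Pu Pv; apply: subD => //; apply: subN. Qed.

Lemma sub_sum I (s : seq I) (Q : pred I) (F : I -> A) :
  (forall i, Q i -> P (F i)) -> P (\sum_(i <- s | Q i) F i).
Proof. by move=> PF; apply: big_ind => //; [apply: sub0P | apply: subD]. Qed.
End Closure.

Definition subS (A : lmodType K) (P Q : subspace A) := forall v, P v -> Q v.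

Program Definition zeroS (A : lmodType K) := @Subspace A (fun v => v = 0) _ _.
Next Obligation. by rewrite scaler0 addr0. Qed.

Program Definition fullS (A : lmodType K) := @Subspace A (fun v => True) _ _.

Program Definition capS (A : lmodType K) (P Q : subspace A) :=
  @Subspace A (fun v => P v /\ Q v) _ _.
Next Obligation. by split; apply: sub0P. Qed.
Next Obligation. by split; apply: subLP. Qed.

Program Definition prodS (A B : lmodType K) (P : subspace A) (Q : subspace B) :=
  @Subspace (A * B)%type (fun v => P v.1 /\ Q v.2) _ _.
Next Obligation. by split; apply: sub0P. Qed.
Next Obligation. by split; apply: subLP. Qed.

Program Definition preS (A B : lmodType K) (f : {linear A -> B})
    (Q : subspace B) := @Subspace A (fun v => Q (f v)) _ _.
Next Obligation. by rewrite linear0; apply: sub0P. Qed.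
Next Obligation. by rewrite linearP; apply: subLP. Qed.

Lemma imS_subproof (A B : lmodType K) (f : {linear A -> B}) (P : subspace A)
    a (x y : B) :
  (exists2 v, P v & f v = x) -> (exists2 v, P v & f v = y) ->
  exists2 v, P v & f v = a *: x + y.
Proof.
move=> [v Pv <-] [w Pw <-].
by exists (a *: v + w); rewrite ?linearP //; apply: subLP.
Qed.

Definition imS (A B : lmodType K) (f : {linear A -> B}) (P : subspace A) :=
  @Subspace B (fun w => exists2 v, P v & f v = w)
    (ex_intro2 _ _ 0 (sub0P P) (linear0 f)) (@imS_subproof A B f P).

Definition kerS (A B : lmodType K) (f : {linear A -> B}) := preS f (zeroS B).

(** [d] is the dimension of the subquotient Z / B.  Stated through a basis modulo
    [B], it makes sense without any finiteness of the ambient space; the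
    free modules of a resolution provide such bases. *)
Definition qdim (A : lmodType K) (Z B : subspace A) (d : nat) : Prop :=
  exists e : 'I_d -> A,
  [/\ forall j, Z (e j),
      forall u, Z u -> exists a : 'I_d -> K, B (u - \sum_j a j *: e j) &
      forall a : 'I_d -> K, B (\sum_j a j *: e j) -> forall j, a j = 0].

(** The transition matrices between two bases of Z / B multiply to the identity,
    and a matrix with [d'] columns has rank at most [d']. *)
Lemma qdim_le (A : lmodType K) (Z B : subspace A) d d' :
  qdim Z B d -> qdim Z B d' -> (d <= d')%N.
Proof.
case=> e [Ze gene free] [e' [Ze' gene' _]].
have /fin_all_exists[M MP] j := gene' _ (Ze j).
have /fin_all_exists[N NP] l := gene _ (Ze' l).
pose m := \matrix_(j, l) M j l; pose q := \matrix_(l, j) N l j.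
(* comparing the two expansions of e j modulo B *)
suff mq1 : m *m q = 1%:M.
  by rewrite -(mxrank1 K d) -mq1 (leq_trans (mxrankM_maxl _ _)) // rank_leq_col.
apply/matrixP => j k; apply/eqP; rewrite -subr_eq0; apply/eqP.
pose a k' := (m *m q) j k' - 1%:M j k'.
apply: (free a _ k).
have -> : \sum_k' a k' *: e k' =
    - (e j - \sum_l M j l *: e' l)
    - \sum_l M j l *: (e' l - \sum_j' N l j' *: e j').
  rewrite opprB; apply/eqP; rewrite eq_sym subr_eq eq_sym; apply/eqP.
  transitivity ((\sum_k' (m *m q) j k' *: e k' - e j)
     + (\sum_l M j l *: e' l - \sum_k' (m *m q) j k' *: e k')).
    congr (_ + _).
      rewrite -[X in _ - X](_ : \sum_k' 1%:M j k' *: e k' = e j).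
        by rewrite -sumrB; apply: eq_bigr => k' _; rewrite scalerBl.
      rewrite (bigD1 j) //= mxE eqxx scale1r big1 ?addr0 // => k' jk'.
      by rewrite mxE eq_sym (negPf jk') scale0r.
    transitivity (\sum_l M j l *: e' l
        - \sum_l M j l *: \sum_j' N l j' *: e j'); last first.
      congr (_ - _); under eq_bigr => l _ do rewrite scaler_sumr.
      rewrite exchange_big /=; apply: eq_bigr => k' _.
      rewrite mxE scaler_suml; apply: eq_bigr => l _.
      by rewrite !mxE scalerA.
    by rewrite -sumrB; apply: eq_bigr => l _; rewrite scalerBr.
  by rewrite addrC addrA subrK.
apply: subB; first by apply: subN.
by apply: sub_sum => l _; apply: subZ.
Qed.

Lemma qdim_uniq (A : lmodType K) (Z B : subspace A) d d' :
  qdim Z B d -> qdim Z B d' -> d = d'.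
Proof.
by move=> h h'; apply/eqP; rewrite eqn_leq (qdim_le h h') (qdim_le h' h).
Qed.

Lemma qdim0 (A : lmodType K) (Z B : subspace A) d :
  qdim Z B d -> subS Z B -> d = 0%N.
Proof.
case=> e [Ze _ free] ZB; case: d e Ze free => // d e Ze free.
have := free (fun=> 1) _ ord0; rewrite (_ : (1 = 0 :> K) <-> False); last first.
  by split=> // /eqP; rewrite oner_eq0.
by case; apply: sub_sum => j _; apply: subZ; apply: ZB.
Qed.

Lemma qdim_rel_imp (A A' : lmodType K) (Z B : subspace A) (Z' B' : subspace A')
    (R : subspace (A * A')%type) d :
  (forall z, Z z -> exists2 z', Z' z' & R (z, z')) ->
  (forall z', Z' z' -> exists2 z, Z z & R (z, z')) ->
  (forall z z', Z z -> Z' z' -> R (z, z') -> (B z <-> B' z')) ->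
  qdim Z B d -> qdim Z' B' d.
Proof.
move=> tot onto RB [e [Ze gene free]].
have /fin_all_exists[e' e'P] j : exists z', Z' z' /\ R (e j, z').
  by have [z' ? ?] := tot _ (Ze j); exists z'.
have Rsum (a : 'I_d -> K) : R (\sum_j a j *: e j, \sum_j a j *: e' j).
  have -> : (\sum_j a j *: e j, \sum_j a j *: e' j) =
      \sum_j a j *: ((e j, e' j) : (A * A')%type).
    rewrite [RHS]surjective_pairing; congr pair.
      by rewrite (raddf_sum fst).
    by rewrite (raddf_sum snd).
  by apply: sub_sum => j _; apply: subZ; case: (e'P j).
exists e'; split=> [j|u' Zu'|a Ba].
- by case: (e'P j).
- have [u Zu Ruu'] := onto _ Zu'.
  have [a Ba] := gene u Zu; exists a.
  apply/(RB (u - \sum_j a j *: e j)) => //.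
  + by apply: subB => //; apply: sub_sum => j _; apply: subZ.
  + by apply: subB => //; apply: sub_sum => j _; apply: subZ; case: (e'P j).
  exact: (subB Ruu' (Rsum a)).
apply: free; apply/(RB _ (\sum_j a j *: e' j)) => //.
  by apply: sub_sum => j _; apply: subZ.
by apply: sub_sum => j _; apply: subZ; case: (e'P j).
Qed.

Program Definition flipS (A A' : lmodType K) (R : subspace (A * A')%type) :=
  @Subspace (A' * A)%type (fun w => R (w.2, w.1)) _ _.
Next Obligation. exact: sub0P. Qed.
Next Obligation. exact: (subLP a H H0). Qed.

(** A linear relation that is total on both sides and identifies boundaries with
    boundaries induces an isomorphism of subquotients.  Relations are used
    instead of maps so that connecting homomorphisms need no choice of lifts. *)
Lemma qdim_rel (A A' : lmodType K) (Z B : subspace A) (Z' B' : subspace A')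
    (R : subspace (A * A')%type) d :
  (forall z, Z z -> exists2 z', Z' z' & R (z, z')) ->
  (forall z', Z' z' -> exists2 z, Z z & R (z, z')) ->
  (forall z z', Z z -> Z' z' -> R (z, z') -> (B z <-> B' z')) ->
  qdim Z B d <-> qdim Z' B' d.
Proof.
move=> tot onto RB; split; first exact: (qdim_rel_imp tot onto RB).
apply: (@qdim_rel_imp _ _ _ _ _ _ (flipS R)) => //= z z' Zz Zz' Rzz'.
by split=> /(RB z' z Zz' Zz Rzz').
Qed.

Lemma modS_subproof (A A' : lmodType K) (f : {linear A -> A'})
    (B' : subspace A') a (v w : A * A') :
  B' (v.2 - f v.1) -> B' (w.2 - f w.1) ->
  B' ((a *: v + w).2 - f (a *: v + w).1).
Proof.
move=> Bv Bw.
have -> : (a *: v + w).2 - f (a *: v + w).1 =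
    a *: (v.2 - f v.1) + (w.2 - f w.1).
  by rewrite -[(a *: v + w).1]/(a *: v.1 + w.1) (linearP f) opprD scalerBr addrACA.
exact: subLP.
Qed.

Program Definition modS (A A' : lmodType K) (f : {linear A -> A'})
  (B' : subspace A') :=
  @Subspace (A * A')%type (fun w => B' (w.2 - f w.1)) _ (@modS_subproof A A' f B').
Next Obligation. by rewrite linear0 subrr; apply: sub0P. Qed.

Lemma qdim_map (A A' : lmodType K) (Z B : subspace A) (Z' B' : subspace A')
    (f : {linear A -> A'}) d :
  (forall z, Z z -> Z' (f z)) ->
  (forall z', Z' z' -> exists2 z, Z z & B' (z' - f z)) ->
  (forall z, Z z -> (B z <-> B' (f z))) ->
  qdim Z B d <-> qdim Z' B' d.
Proof.
move=> fZ onto fB; apply: (@qdim_rel _ _ _ _ _ _ (modS f B')) => [z Zz|z' Zz'|z z'].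
- by exists (f z) => /=; [apply: fZ | rewrite subrr; apply: sub0P].
- exact: onto.
move=> Zz Zz' /= Rzz'; split=> [/(fB _ Zz) Bz|Bz'].
  by rewrite -[z'](subrK (f z)); apply: subD.
by apply/(fB _ Zz); rewrite -[f z](subKr z'); apply: subB.
Qed.

Lemma spanS_subproof (C A A' : lmodType K) (f : {linear C -> A})
    (g : {linear C -> A'}) (P : subspace C) a (x y : A * A') :
  (exists2 v, P v & f v = x.1 /\ g v = x.2) ->
  (exists2 v, P v & f v = y.1 /\ g v = y.2) ->
  exists2 v, P v & f v = (a *: x + y).1 /\ g v = (a *: x + y).2.
Proof.
move=> [v Pv [fv gv]] [w Pw [fw gw]]; exists (a *: v + w); first exact: subLP.
by rewrite !linearP fv gv fw gw.
Qed.

Program Definition spanS (C A A' : lmodType K) (f : {linear C -> A})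
    (g : {linear C -> A'}) (P : subspace C) :=
  @Subspace (A * A')%type (fun w => exists2 v, P v & f v = w.1 /\ g v = w.2)
    _ (@spanS_subproof C A A' f g P).
Next Obligation. by exists 0; rewrite ?linear0 //; apply: sub0P. Qed.

End Subspace.

(** * Koszul complexes of families of subspaces *)

Section Koszul.
Variable K : fieldType.
Implicit Types A B : lmodType K.

(** Chains of all degrees at once: the 2^m coordinates, one for each subset of
    the m directions, arranged as iterated pairs.  The second half of a pair
    collects the subsets that contain the first direction. *)
Fixpoint kosz (A : lmodType K) (m : nat) : lmodType K :=
  match m with
  | 0 => A
  | m'.+1 => (kosz A m' * kosz A m')%type
  end.

(** The Koszul differential for directions that all act as the identity: each
    new direction takes the cone of the identity. *)
Fixpoint kd_fun (A : lmodType K) (m : nat) : kosz A m -> kosz A m :=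
  match m return kosz A m -> kosz A m with
  | 0 => fun=> 0
  | m'.+1 => fun z => (kd_fun z.1 + z.2, - kd_fun z.2)
  end.

Lemma kd_linear A m : linear (@kd_fun A m).
Proof.
elim: m => [|m IHm] a u v /=; first by rewrite scaler0 addr0.
case: u v => [u1 u2] [v1 v2] /=; congr pair; rewrite IHm /=.
  transitivity (a *: (kd_fun u1 + u2) + (kd_fun v1 + v2)) => //.
  by rewrite scalerDr addrACA.
transitivity (a *: - kd_fun u2 - kd_fun v2) => //.
by rewrite opprD scalerN.
Qed.

HB.instance Definition _ A m :=
  GRing.isLinear.Build K (kosz A m) (kosz A m) _ (@kd_fun A m) (@kd_linear A m).

Fact kd_key : unit. Proof. by []. Qed.
Definition kd A m : {linear kosz A m -> kosz A m} :=
  locked_with kd_key (@kd_fun A m : {linear kosz A m -> kosz A m}).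

Lemma kdS A m (z : kosz A m.+1) :
  kd A m.+1 z = (kd A m z.1 + z.2, - kd A m z.2) :> kosz A m.+1.
Proof. by rewrite /kd !unlock. Qed.

Lemma kd0 A (z : kosz A 0) : kd A 0 z = 0.
Proof. by rewrite /kd !unlock. Qed.

Lemma kd_kd A m (z : kosz A m) : kd A m (kd A m z) = 0.
Proof.
elim: m z => [|m IHm] z; rewrite ?kd0 // !kdS /=.
by rewrite linearD IHm add0r subrr linearN IHm !oppr0.
Qed.

(** The chains of degree [i] of the Koszul complex of [P] and the family [ys]:
    the coordinate at a subset T lies in the intersection of [P] with the
    members of [ys] indexed by T, and vanishes unless T has [i] elements.
    The degree is an integer so that shifting it down needs no case distinction. *)
Fixpoint chain_def A (m : nat) (ys : seq (subspace A)) (P : subspace A) (i : int) :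
    subspace (kosz A m) :=
  match m return subspace (kosz A m) with
  | 0 => if i == 0 then P else zeroS A
  | m'.+1 => prodS (chain_def m' (behead ys) P i)
       (chain_def m' (behead ys) (capS P (head (fullS A) ys)) (i - 1))
  end.

Fact chain_key : unit. Proof. by []. Qed.
(** Locked, as is [kd], so that simplification does not unfold them on
    successors; [chain0], [chainS], [kd0] and [kdS] replace the unfolding. *)
Definition chain := locked_with chain_key chain_def.
Arguments chain {A} m ys P i.
Arguments kosz : simpl never.

Lemma chain0 A ys (P : subspace A) i z :
  chain 0 ys P i z = (if i == 0 then P else zeroS A) z.
Proof. by rewrite /chain unlock. Qed.

Lemma chainS A m ys (P : subspace A) i z :
  chain m.+1 ys P i z = (chain m (behead ys) P i z.1 /\
    chain m (behead ys) (capS P (head (fullS A) ys)) (i - 1) z.2).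
Proof. by rewrite /chain unlock. Qed.

Definition cycles A m ys P i := capS (@chain A m ys P i) (kerS (kd A m)).
Definition bounds A m ys P i := imS (kd A m) (@chain A m ys P (i + 1)).
Definition acyclic A m ys P := forall i, subS (@cycles A m ys P i) (bounds m ys P i).
Definition hdim A m ys P i d := qdim (@cycles A m ys P i) (bounds m ys P i) d.

Lemma capS_sub A (P Q R : subspace A) : subS P Q -> subS (capS P R) (capS Q R).
Proof. by move=> PQ v []; split; auto. Qed.

Lemma chain_sub A m ys (P Q : subspace A) i :
  subS P Q -> subS (chain m ys P i) (chain m ys Q i).
Proof.
elim: m ys P Q i => [|m IHm] ys P Q i PQ z.
  by rewrite !chain0; case: ifP => _ //; apply: PQ.
rewrite !chainS => -[zP zQ].
by split; [apply: IHm zP | apply: IHm zQ; apply: capS_sub].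
Qed.

Lemma chain_cap A m ys (P Q : subspace A) i :
  subS (chain m ys (capS P Q) i) (chain m ys P i).
Proof. by apply: chain_sub => v []. Qed.

Lemma chain_kd A m ys (P : subspace A) i z :
  chain m ys P i z -> chain m ys P (i - 1) (kd A m z).
Proof.
elim: m ys P i z => [|m IHm] ys P i z; first by move=> _; rewrite kd0; apply: sub0P.
rewrite !chainS kdS => -[Pu Pv]; split=> /=.
  by apply: subD; [apply: IHm | apply: chain_cap Pv].
by apply: subN; apply: IHm.
Qed.

Lemma chain_zero A m ys (P : subspace A) i z :
  subS P (zeroS A) -> chain m ys P i z -> z = 0.
Proof.
elim: m ys P i z => [|m IHm] ys P i z P0.
  by rewrite chain0; case: ifP => // _; apply: P0.
case: z => u v; rewrite chainS /= => -[/IHm -> // /IHm -> // w [/P0]].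
by [].
Qed.

Lemma chain_neg A m ys (P : subspace A) i z :
  i < 0 -> chain m ys P i z -> z = 0.
Proof.
elim: m ys P i z => [|m IHm] ys P i z i0.
  by rewrite chain0; case: eqP => // i0'; lia.
by case: z => u v; rewrite chainS /= => -[/IHm -> // /IHm -> //]; lia.
Qed.

Lemma acyclic_zero A m ys (P : subspace A) :
  subS P (zeroS A) -> acyclic m ys P.
Proof.
by move=> P0 i z [/(chain_zero P0) -> _]; apply: sub0P.
Qed.

Lemma kd_eq0 A m (z : kosz A m.+1) :
  kd A m.+1 z = 0 -> z.2 = - kd A m z.1 /\ kd A m z.2 = 0.
Proof.
rewrite kdS => -[/eqP duv /eqP dv]; rewrite oppr_eq0 in dv.
by split; apply/eqP => //; rewrite -addr_eq0 addrC.
Qed.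

(** If the member [y] containing [P] comes first, the complex is the cone of an
    identity map.  Otherwise it is the cone of a map between two complexes which
    both have [y] in their family, hence are exact by induction. *)
Lemma acyclic_sub A m ys (P : subspace A) y :
  List.In y ys -> size ys = m -> subS P y -> acyclic m ys P.
Proof.
move=> + + + i; elim: m ys P i => [|m IHm] [|x ys] P i //.
move=> [xy|yys] [sz] Py z [+ /kd_eq0[duv dv]]; rewrite chainS /= => -[Pu Pv].
  subst x; exists ((0, z.1) : kosz A m.+1).
    rewrite chainS /= addrK; split; first exact: sub0P.
    by apply: chain_sub Pu => w Pw; split; auto.
  by rewrite kdS /= linear0 add0r -duv -surjective_pairing.
have Pxy : subS (capS P x) y by move=> w [/Py].
have [|e Pe de] := IHm ys _ (i - 1) yys sz Pxy z.2; first by split.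
rewrite subrK in Pe.
have [|p Pp dp] := IHm ys P i yys sz Py (z.1 + e).
  split; first by apply: subD => //; apply: chain_cap Pe.
  by rewrite /= linearD de duv subrr.
exists ((p, - e) : kosz A m.+1).
  by rewrite chainS /= addrK; split=> //; apply: subN.
by rewrite kdS /= dp linearN de opprK addrK -surjective_pairing.
Qed.

Definition kinc_fun A m (u : kosz A m) : kosz A m.+1 := (u, 0).
Lemma kinc_linear A m : linear (@kinc_fun A m).
Proof.
by move=> a u v; congr pair; rewrite /= scaler0 addr0.
Qed.
HB.instance Definition _ A m :=
  GRing.isLinear.Build K (kosz A m) (kosz A m.+1) _ (@kinc_fun A m) (@kinc_linear A m).
Definition kinc A m : {linear kosz A m -> kosz A m.+1} := @kinc_fun A m.

(** Adjoining [y] takes the cone of the inclusion of the complex of (P cap y; ys)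
    in the complex of (P; ys); when the former is exact the homology is that of
    the latter. *)
Lemma hdim_drop A m ys (y P : subspace A) i d :
  acyclic m ys (capS P y) -> hdim m ys P i d <-> hdim m.+1 (y :: ys) P i d.
Proof.
move=> ac; apply: (@qdim_map _ _ _ _ _ _ _ (@kinc A m)).
- move=> z [Pz dz]; split; first by rewrite chainS; split=> //; apply: sub0P.
  by rewrite /= kdS /= dz addr0 linear0 oppr0.
- move=> z [+ /kd_eq0[duv dv]]; rewrite chainS /= => -[Pu Pv].
  have [|e Pe de] := ac (i - 1) z.2; first by [].
  rewrite subrK in Pe; exists (z.1 + e).
    split; first by apply: subD => //; apply: chain_cap Pe.
    by rewrite /= linearD de duv subrr.
  exists ((0, - e) : kosz A m.+1).
    by rewrite chainS /= addrK; split; [apply: sub0P | apply: subN].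
  rewrite kdS /= linear0 add0r linearN opprK de.
  by rewrite [RHS]surjective_pairing /= opprD addNKr subr0.
move=> z [Pz dz]; split=> [[w Pw dw]|[w]].
  exists (kinc A m w); first by rewrite chainS; split=> //; apply: sub0P.
  by rewrite kdS /= dw addr0 linear0 oppr0.
rewrite chainS /= kdS => -[Pp Pq] [dpq] /eqP; rewrite oppr_eq0 => /eqP dq.
have [|r Pr dr] := ac (i + 1 - 1) w.2; first by [].
rewrite subrK in Pr; exists (w.1 + r).
  by apply: subD => //; apply: chain_cap Pr.
by rewrite linearD dr.
Qed.

(** The isomorphism is required to work for all [P] at once: this is what makes
    it pass to the cones in [kiso_cons]. *)
Definition kiso A m (ys ys' : seq (subspace A)) : Prop :=
  exists f g : {linear kosz A m -> kosz A m},
  [/\ cancel f g, cancel g f, forall z, f (kd A m z) = kd A m (f z) &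
   forall P i z, chain m ys P i z <-> chain m ys' P i (f z)].

Lemma kiso_hdim A m ys ys' (P : subspace A) i d :
  kiso m ys ys' -> hdim m ys P i d <-> hdim m ys' P i d.
Proof.
move=> [f [g [fK gK fd fP]]]; apply: (@qdim_map _ _ _ _ _ _ _ f).
- by move=> z [/fP Pz dz]; split=> //=; rewrite -fd dz linear0.
- move=> z' [Pz dz]; exists (g z'); last by rewrite gK subrr; apply: sub0P.
  split; first by apply/fP; rewrite gK.
  by rewrite /= -[LHS]fK fd gK dz linear0.
move=> z _; split=> [] [w Pw].
  by move=> <-; exists (f w); rewrite ?fd //; apply/fP.
move=> dw; exists (g w); first by apply/fP; rewrite gK.
by apply: (can_inj fK); rewrite fd gK.
Qed.

Definition kprod_fun A m (f : {linear kosz A m -> kosz A m})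
  (z : kosz A m.+1) : kosz A m.+1 := (f z.1, f z.2).
Lemma kprod_linear A m f : linear (@kprod_fun A m f).
Proof. by move=> a u v; congr pair; rewrite -(linearP f). Qed.
HB.instance Definition _ A m f :=
  GRing.isLinear.Build K (kosz A m.+1) (kosz A m.+1) _ (@kprod_fun A m f)
   (@kprod_linear A m f).

Definition kswap_fun A m (z : kosz A m.+2) : kosz A m.+2 :=
  ((z.1.1, z.2.1), (z.1.2, - z.2.2)).
Lemma kswap_linear A m : linear (@kswap_fun A m).
Proof.
move=> a u v; congr pair; congr pair.
by rewrite -[RHS]/(a *: - u.2.2 - v.2.2) scalerN -opprD.
Qed.
HB.instance Definition _ A m :=
  GRing.isLinear.Build K (kosz A m.+2) (kosz A m.+2) _ (@kswap_fun A m)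
   (@kswap_linear A m).

Lemma kswapK A m : involutive (@kswap_fun A m).
Proof. by move=> [[a b] [c e]]; rewrite /kswap_fun /= opprK. Qed.

Lemma kiso_refl A m (ys : seq (subspace A)) : kiso m ys ys.
Proof. by exists idfun, idfun; split. Qed.

Lemma kiso_trans A m (ys ys' ys'' : seq (subspace A)) :
  kiso m ys ys' -> kiso m ys' ys'' -> kiso m ys ys''.
Proof.
move=> [f [g [fK gK fd fP]]] [f' [g' [fK' gK' fd' fP']]].
exists (f' \o f), (g \o g'); split=> [z|z|z|P i z] /=.
- by rewrite fK' fK.
- by rewrite gK gK'.
- by rewrite fd fd'.
by rewrite fP fP'.
Qed.

Lemma kiso_cons A m (y : subspace A) ys ys' :
  kiso m ys ys' -> kiso m.+1 (y :: ys) (y :: ys').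
Proof.
move=> [f [g [fK gK fd fP]]]; exists (kprod_fun f), (kprod_fun g); split.
- by move=> z; rewrite /= /kprod_fun /= !fK -surjective_pairing.
- by move=> z; rewrite /= /kprod_fun /= !gK -surjective_pairing.
- by move=> z; rewrite /= /kprod_fun !kdS /= linearD linearN !fd.
by move=> P i z; rewrite !chainS /= !fP.
Qed.

(** Exchanging the first two directions is a chain map once the coordinates at
    the subsets containing both change sign. *)
Lemma kiso_swap A m (x y : subspace A) ys :
  kiso m.+2 (x :: y :: ys) (y :: x :: ys).
Proof.
exists (@kswap_fun A m), (@kswap_fun A m); split; try exact: kswapK.
  move=> z; rewrite /= /kswap_fun !kdS /= ?kdS /=.
  congr pair; rewrite [RHS]surjective_pairing /=; congr pair.
  - by rewrite addrAC.
  - by rewrite opprD.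
  - by rewrite opprB addrC.
  - by rewrite (linearN (kd A m)).
move=> P i z; rewrite !chainS /= ?chainS /=.
have cc i' t : chain m ys (capS (capS P x) y) i' t <->
    chain m ys (capS (capS P y) x) i' t.
  by split; apply: chain_sub => v [[]].
rewrite cc; split=> [[[? ?] [? ?]]|[[? ?] [? /subN h]]]; do !split=> //.
  exact: subN.
by rewrite opprK in h.
Qed.

Lemma kiso_perm A (ys ys' : seq (subspace A)) m :
  Permutation ys ys' -> size ys = m -> kiso m ys ys'.
Proof.
move=> p; elim: p m => [|y s s' _ IH|x y s|s s' s'' p IH _ IH'] m sz.
- exact: kiso_refl.
- by case: m sz => // m [sz]; apply: kiso_cons; apply: IH.
- by case: m sz => // -[//|m] [sz]; apply: kiso_swap.
apply: kiso_trans (IH m sz) (IH' m _).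
by rewrite -sz; symmetry; apply: Permutation_length p.
Qed.

(** The condition under which [y] can be adjoined to [ys] without changing the
    homology. *)
Definition dominated A (P : subspace A) (y : subspace A) ys :=
  subS (capS P y) (zeroS A) \/ exists2 x, List.In x ys & subS (capS P y) x.

Lemma hdim_absorb A (ys ys' : seq (subspace A)) P i d :
  (forall y, List.In y ys' -> dominated P y ys) ->
  hdim (size ys) ys P i d <-> hdim (size (ys' ++ ys)) (ys' ++ ys) P i d.
Proof.
elim: ys' => [|y ys' IH] dom //; rewrite IH; last by move=> x xs; apply: dom; right.
apply: hdim_drop; have [/acyclic_zero|[x xs yx]] := dom y (or_introl erefl); first exact.
apply: (acyclic_sub (y := x)) => //.
elim: (ys') xs => //= z s IHs /IHs; by right.
Qed.

(** Both families have the homology of their concatenation, by [hdim_absorb]. *)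
Lemma hdim_cofinal A (ys ys' : seq (subspace A)) P i d :
  (forall y, List.In y ys -> dominated P y ys') ->
  (forall y, List.In y ys' -> dominated P y ys) ->
  hdim (size ys) ys P i d <-> hdim (size ys') ys' P i d.
Proof.
move=> h h'; rewrite (hdim_absorb _ _ h') (hdim_absorb _ _ h).
rewrite !size_cat addnC; apply: kiso_hdim; apply: kiso_perm.
  exact: Permutation_app_comm.
by rewrite size_cat addnC.
Qed.

End Koszul.

(** * Functoriality of the Koszul complex *)

Section Functoriality.
Variable K : fieldType.
Implicit Types A B : lmodType K.

Fixpoint kmap_fun A B (f : {linear A -> B}) m : kosz A m -> kosz B m :=
  match m return kosz A m -> kosz B m with
  | 0 => f
  | m'.+1 => fun z => (kmap_fun f z.1, kmap_fun f z.2)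
  end.

Lemma kmap_linear A B (f : {linear A -> B}) m : linear (@kmap_fun A B f m).
Proof.
by elim: m => [|m IHm] a u v; [exact: linearP | congr pair; rewrite -IHm].
Qed.

HB.instance Definition _ A B f m :=
  GRing.isLinear.Build K (kosz A m) (kosz B m) _ (@kmap_fun A B f m)
   (@kmap_linear A B f m).

Fact kmap_key : unit. Proof. by []. Qed.
Definition kmap A B f m : {linear kosz A m -> kosz B m} :=
  locked_with kmap_key (@kmap_fun A B f m : {linear kosz A m -> kosz B m}).

Lemma kmap0 A B (f : {linear A -> B}) (z : kosz A 0) : kmap f 0 z = f z.
Proof. by rewrite /kmap !unlock. Qed.

Lemma kmapS A B (f : {linear A -> B}) m (z : kosz A m.+1) :
  kmap f m.+1 z = (kmap f m z.1, kmap f m z.2) :> kosz B m.+1.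
Proof. by rewrite /kmap !unlock. Qed.

Lemma kmap_kd A B (f : {linear A -> B}) m z :
  kmap f m (kd A m z) = kd B m (kmap f m z).
Proof.
elim: m z => [|m IHm] z; first by rewrite kmap0 !kd0 linear0.
by rewrite kmapS !kdS kmapS /= linearD (linearN (kmap f m)) !IHm.
Qed.

Lemma kmap_chain T A B (f : {linear A -> B}) m (W : T -> subspace A)
    (W' : T -> subspace B) ts (P : subspace A) (P' : subspace B) i z :
  (forall t, subS (W t) (preS f (W' t))) -> subS P (preS f P') ->
  chain m (map W ts) P i z -> chain m (map W' ts) P' i (kmap f m z).
Proof.
move=> WW; elim: m ts P P' i z => [|m IHm] ts P P' i z PP.
  rewrite !chain0 kmap0; case: ifP => _; first exact: PP.
  by move=> -> /=; rewrite linear0.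
rewrite !chainS kmapS /= !behead_map => -[Pu Pv]; split; first exact: IHm Pu.
apply: IHm Pv => v [Pv yv]; split; first exact: PP.
by case: (ts) yv => //= t s; apply: WW.
Qed.

(** Injectivity matters for the coordinates that are required to vanish. *)
Lemma kmap_pre A B (f : {linear A -> B}) m ys (P : subspace B) i z :
  injective f ->
  chain m (map (preS f) ys) (preS f P) i z <-> chain m ys P i (kmap f m z).
Proof.
move=> finj; elim: m ys P i z => [|m IHm] ys P i z.
  rewrite !chain0 kmap0; case: ifP => _ //=; split=> [->|]; first by rewrite linear0.
  by move=> h; apply: finj; rewrite h linear0.
rewrite !chainS kmapS /= !behead_map -!IHm.
have h : subS (capS (preS f P) (head (fullS A) (map (preS f) ys)))
              (preS f (capS P (head (fullS B) ys))) by case: (ys) => [|y s] v [].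
have h' : subS (preS f (capS P (head (fullS B) ys)))
    (capS (preS f P) (head (fullS A) (map (preS f) ys))) by case: (ys) => [|y s] v [].
by split=> -[? hz]; split=> //; [apply: chain_sub h _ hz|apply: chain_sub h' _ hz].
Qed.

Lemma kmap_bij A B (f : {linear A -> B}) m :
  bijective f -> bijective (kmap f m).
Proof.
move=> [g fK gK]; elim: m => [|m [h hK kK]].
  by exists g => z; rewrite kmap0.
exists (fun z : kosz B m.+1 => (h z.1, h z.2) : kosz A m.+1) => z;
  by rewrite kmapS /= ?hK ?kK -surjective_pairing.
Qed.

Lemma hdim_pre A B (f : {linear A -> B}) m ys (P : subspace B) i d :
  bijective f ->
  hdim m (map (preS f) ys) (preS f P) i d <-> hdim m ys P i d.
Proof.
move=> fbij; have finj := bij_inj fbij.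
have [g fK gK] := kmap_bij m fbij.
apply: (@qdim_map _ _ _ _ _ _ _ (kmap f m)).
- move=> z [/(kmap_pre _ _ _ _ finj) Pz dz]; split=> //=.
  by rewrite -kmap_kd dz linear0.
- move=> z' [Pz dz]; exists (g z'); last by rewrite gK subrr; apply: sub0P.
  split; first by apply/(kmap_pre _ _ _ _ finj); rewrite gK.
  by apply: (can_inj fK); rewrite kmap_kd gK dz linear0.
move=> z _; split=> [] [w Pw dw].
  exists (kmap f m w); first exact/(kmap_pre _ _ _ _ finj).
  by rewrite -kmap_kd dw.
exists (g w); first by apply/(kmap_pre _ _ _ _ finj); rewrite gK.
by apply: (can_inj fK); rewrite kmap_kd gK.
Qed.

Fixpoint kemb_fun A m : A -> kosz A m :=
  match m return A -> kosz A m with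
  | 0 => id
  | m'.+1 => fun v => (kemb_fun m' v, 0)
  end.
Lemma kemb_linear A m : linear (@kemb_fun A m).
Proof.
elim: m => [|m IHm] a u v //=; rewrite IHm.
by rewrite [RHS]surjective_pairing /= scaler0 addr0.
Qed.
HB.instance Definition _ A m :=
  GRing.isLinear.Build K A (kosz A m) _ (@kemb_fun A m) (@kemb_linear A m).
Definition kemb A m : {linear A -> kosz A m} := @kemb_fun A m.

Lemma kemb_inj A m : injective (kemb A m).
Proof. by elim: m => [|m IHm] u v // [/IHm]. Qed.

Lemma kmap_kemb A B (f : {linear A -> B}) m v : kmap f m (kemb A m v) = kemb B m (f v).
Proof.
elim: m => [|m IHm]; first by rewrite kmap0.
by rewrite kmapS /= -!/(kemb _ _) linear0 IHm.
Qed.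

Lemma kd_kemb A m v : kd A m (kemb A m v) = 0.
Proof.
elim: m => [|m IHm]; first by rewrite kd0.
by rewrite kdS /= linear0 oppr0 addr0 [X in (X, _)]IHm.
Qed.

Lemma chain_kemb A m ys (P : subspace A) v : P v -> chain m ys P 0 (kemb A m v).
Proof.
move=> Pv; elim: m ys => [|m IHm] ys; first by rewrite chain0.
by rewrite chainS; split; [apply: IHm | apply: sub0P].
Qed.

Lemma chain_deg0 A m ys (P : subspace A) z :
  chain m ys P 0 z -> exists2 v, P v & z = kemb A m v.
Proof.
elim: m ys z => [|m IHm] ys z; first by rewrite chain0 eqxx; exists z.
rewrite chainS => -[/IHm[v Pv zv] /chain_neg z2]; exists v => //.
by rewrite [LHS]surjective_pairing z2 // zv.
Qed.

(** All the terms indexed by nonempty subsets vanish, so the complex is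
    concentrated in degree 0. *)
Lemma chain_faces0 A m ys (P : subspace A) i z :
  size ys = m -> (forall y, List.In y ys -> subS (capS P y) (zeroS A)) ->
  i != 0 -> chain m ys P i z -> z = 0.
Proof.
elim: m ys z => [|m IHm] [|y ys] z //; first by rewrite chain0 => _ _ /negPf ->.
move=> [sz] ys0 i0; rewrite chainS /= => -[u0 v0].
rewrite [LHS]surjective_pairing (IHm _ _ sz _ i0 u0); last by move=> x xs; apply: ys0; right.
by rewrite (chain_zero _ v0) //; apply: ys0; left.
Qed.

End Functoriality.

(** * Filtered spaces and dimension shifting *)

Section Filtration.
Variables (K : fieldType) (n : nat).
Implicit Types A B : lmodType K.

Definition dmin (b c : degree n) : degree n := [ffun k => Num.min (b k) (c k)].
Definition dunit (k : 'I_n) : degree n := [ffun j => (j == k)%:Z].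
(** The subspaces W_(c - e_k), k in [n], of W_c define the Koszul complex in
    degree c. *)
Definition faces (c : degree n) := [seq c - dunit k | k <- enum 'I_n].

Lemma size_faces c : size (faces c) = n.
Proof. by rewrite size_map -cardE card_ord. Qed.

(** The property shared by reflexive modules, free modules and syzygies that lets
    the subspaces W_(c - e_k) determine W_(c - e_T) for all T. *)
Definition filtration A (W : degree n -> subspace A) :=
  forall b c v, W (dmin b c) v <-> W b v /\ W c v.

Lemma filtration_cap A (W : degree n -> subspace A) b c : filtration W ->
  subS (W (dmin b c)) (capS (W b) (W c)) /\ subS (capS (W b) (W c)) (W (dmin b c)).
Proof. by move=> WF; split=> v /WF. Qed.

Definition koszul_chain A (W : degree n -> subspace A) m ds b i :=
  chain m (map W ds) (W b) i.
Definition koszul_dim A (W : degree n -> subspace A) c (i : int) d :=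
  hdim n (map W (faces c)) (W c) i d.

(** Each coordinate of a chain lies in a single W'_b, since intersections of
    members of a filtration are members; so chains lift coordinate by coordinate. *)
Lemma kmap_onto A B (f : {linear A -> B}) (W : degree n -> subspace A)
    (W' : degree n -> subspace B) m ds b i z' :
  filtration W -> filtration W' -> size ds = m ->
  (forall c, subS (W' c) (imS f (W c))) ->
  koszul_chain W' m ds b i z' -> exists2 z, koszul_chain W m ds b i z & kmap f m z = z'.
Proof.
move=> WF WF'; rewrite /koszul_chain.
elim: m ds b i z' => [|m IHm] [|d ds] b i z' // sz onto.
  rewrite chain0; case: ifP => i0.
    by move=> /onto[z Wz fz]; exists z; rewrite ?chain0 ?i0 ?kmap0.
  by move=> ->; exists 0; rewrite ?linear0 //; apply: sub0P.
case: sz => sz; rewrite chainS /= => -[Pu Pv].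
have [u Wu fu] := IHm _ _ _ _ sz onto Pu.
have [v Wv fv] := IHm _ (dmin b d) _ _ sz onto
  (chain_sub (proj2 (filtration_cap b d WF')) Pv).
exists ((u, v) : kosz A m.+1); last by rewrite kmapS fu fv -surjective_pairing.
rewrite chainS; split=> //.
exact: (chain_sub (proj1 (filtration_cap b d WF))).
Qed.

Definition kerW A B (f : {linear A -> B}) (W : degree n -> subspace A) :=
  fun c => capS (W c) (kerS f).

Lemma kerW_filtration A B (f : {linear A -> B}) W :
  filtration W -> filtration (kerW f W).
Proof.
move=> WF b c v; split=> [[/WF[? ?] ?] | [[? ?] [? ?]]]; first by do !split.
by split=> //; apply/WF.
Qed.

Lemma kmap_ker A B (f : {linear A -> B}) W m ds b i z :
  filtration W -> size ds = m ->
  koszul_chain (kerW f W) m ds b i z <-> koszul_chain W m ds b i z /\ kmap f m z = 0.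
Proof.
move=> WF; rewrite /koszul_chain.
elim: m ds b i z => [|m IHm] [|d ds] b i z //.
  rewrite !chain0 kmap0; case: ifP => i0 //= _; split=> [->|[]] //.
  by rewrite linear0.
move=> [sz]; rewrite !chainS kmapS /=.
have [h1 h2] := filtration_cap b d WF.
have [h3 h4] := filtration_cap b d (kerW_filtration f WF).
split=> [[/IHm[//|? ->] /(chain_sub h4)/IHm[//|/(chain_sub h1) ? ->]]|].
  by do !split.
move=> [[? hv] [fu fv]]; split; first exact/IHm.
by apply: (chain_sub h3); apply/IHm => //; split=> //; apply: (chain_sub h2).
Qed.

(** The connecting isomorphism of 0 -> N -> F -> M -> 0, with N = [kerW f W]: a
    cycle of M and a cycle of N correspond when some chain of F maps to the first
    and has the second as differential.  The last two hypotheses say that F has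
    no homology in degree i + 1 and that the map induced by N -> F in degree i
    is zero. *)
Lemma dim_shift A B (f : {linear A -> B}) (W : degree n -> subspace A)
    (W' : degree n -> subspace B) c i d :
  filtration W -> filtration W' ->
  (forall b, subS (W b) (preS f (W' b))) ->
  (forall b, subS (W' b) (imS f (W b))) ->
  subS (cycles n (map W (faces c)) (W c) (i + 1))
    (bounds n (map W (faces c)) (W c) (i + 1)) ->
  subS (cycles n (map (kerW f W) (faces c)) (kerW f W c) i)
    (bounds n (map W (faces c)) (W c) i) ->
  koszul_dim (kerW f W) c i d -> koszul_dim W' c (i + 1) d.
Proof.
move=> WF WF' into onto ac ac0; have sz := size_faces c.
have lift b0 i0 z0 := @kmap_onto _ _ f _ _ n _ b0 i0 z0 WF WF' sz onto.
have kerE b0 i0 z0 := kmap_ker f b0 i0 z0 WF sz.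
rewrite /koszul_chain in lift kerE.
have into' := kmap_chain (m := n) into (into c) (ts := faces c).
suff : koszul_dim W' c (i + 1) d <-> koszul_dim (kerW f W) c i d by case.
apply: (@qdim_rel _ _ _ _ _ _ _
  (spanS (kmap f n) (kd A n) (chain n (map W (faces c)) (W c) (i + 1)))).
- move=> z' [Pz dz]; have [z Wz fz] := lift _ _ _ Pz.
  exists (kd A n z); last by exists z.
  split; last by rewrite /= kd_kd.
  apply/kerE; split; last by rewrite kmap_kd fz dz.
  by have := chain_kd Wz; rewrite addrK.
- move=> x xP; have [w Ww dw] := ac0 x xP; exists (kmap f n w); last by exists w.
  split; first exact: into' Ww.
  by rewrite /= -kmap_kd dw; case: xP => /kerE[].
move=> z x [Pz dz] xP [w Ww [/= fw dw]]; split.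
- move=> [z' Pz' dz']; have [w' Ww' fw'] := lift _ _ _ Pz'.
  exists (w - kd A n w'); last by rewrite linearB kd_kd subr0.
  apply/kerE; split; last by rewrite linearB kmap_kd fw fw' dz' subrr.
  by apply: subB => //; have := chain_kd Ww'; rewrite addrK.
move=> [u /kerE[Wu fu] du].
have [|w'' Ww'' dw''] := ac (w - u).
  by split; [apply: subB | rewrite /= linearB dw du subrr].
exists (kmap f n w''); first exact: into' Ww''.
by rewrite -kmap_kd dw'' linearB fw fu subr0.
Qed.

(** In degree 0 all chains are cycles, and the hypothesis on [kerW f W] says that
    N -> F induces zero on the homology in degree 0, so that F -> M induces an
    isomorphism there. *)
Lemma dim_deg0 A B (f : {linear A -> B}) (W : degree n -> subspace A)
    (W' : degree n -> subspace B) c d :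
  filtration W -> filtration W' ->
  (forall b, subS (W b) (preS f (W' b))) ->
  (forall b, subS (W' b) (imS f (W b))) ->
  subS (cycles n (map (kerW f W) (faces c)) (kerW f W c) 0)
    (bounds n (map W (faces c)) (W c) 0) ->
  koszul_dim W c 0 d -> koszul_dim W' c 0 d.
Proof.
move=> WF WF' into onto ac0; have sz := size_faces c.
have lift b0 i0 z0 := @kmap_onto _ _ f _ _ n _ b0 i0 z0 WF WF' sz onto.
have kerE b0 i0 z0 := kmap_ker f b0 i0 z0 WF sz.
rewrite /koszul_chain in lift kerE.
have into' := kmap_chain (m := n) into (into c) (ts := faces c).
have cyc0 C (U : degree n -> subspace C) z :
    chain n (map U (faces c)) (U c) 0 z -> kd C n z = 0.
  by case/chain_deg0 => v _ ->; rewrite kd_kemb.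
suff : koszul_dim W c 0 d <-> koszul_dim W' c 0 d by case.
apply: (@qdim_map _ _ _ _ _ _ _ (kmap f n)).
- move=> z [Wz dz]; split; first exact: into' Wz.
  by rewrite /= -kmap_kd dz linear0.
- move=> z' [Pz dz]; have [z Wz fz] := lift _ _ _ Pz.
  exists z; last by rewrite fz subrr; apply: sub0P.
  by split=> //; apply: cyc0 Wz.
move=> z [Wz dz]; split=> [[w Ww dw]|[z' Pz' dz']].
  by exists (kmap f n w); [apply: into' Ww | rewrite -kmap_kd dw].
have [w' Ww' fw'] := lift _ _ _ Pz'.
have Wdw' : chain n (map W (faces c)) (W c) 0 (kd A n w').
  by have := chain_kd Ww'; rewrite addrK.
rewrite -[z](subrK (kd A n w')); apply: subD; last by exists w'.
apply: ac0; split; last by rewrite /= linearB dz kd_kd subr0.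
apply/kerE; split; first exact: subB.
by rewrite linearB kmap_kd fw' dz' subrr.
Qed.

End Filtration.

(** * Free modules *)

Section Free.
Variables (K : fieldType) (n r : nat) (d : 'I_r -> degree n).
Local Notation A := 'rV[K]_r.

Definition led (b c : degree n) := [forall k, b k <= c k].

Lemma led_min a b c : led a (dmin b c) = led a b && led a c.
Proof.
apply/forallP/andP => [h|[/forallP hb /forallP hc] k].
  by split; apply/forallP => k; have := h k; rewrite ffunE le_min => /andP[].
by rewrite ffunE le_min hb hc.
Qed.

(** The component of degree c of the free module with generators in the degrees
    [d j], once all variables are set to 1: the generators whose degree is at
    most c span it. *)
Program Definition freeW (c : degree n) : subspace (A : lmodType K) :=
  @Subspace K A (fun v => forall j, v 0 j != 0 -> led (d j) c) _ _.
Next Obligation. by rewrite mxE eqxx in H. Qed.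
Next Obligation.
case: (eqVneq (u 0 j) 0) => [uj|/H //]; apply: H0.
by rewrite !mxE uj mulr0 add0r in H1.
Qed.

Lemma freeW_filtration : filtration freeW.
Proof.
move=> b c v; split=> [h|[hb hc] j vj].
  by split=> j /h; rewrite led_min => /andP[].
by rewrite led_min hb ?hc.
Qed.

Definition proj_fun (j : 'I_r) (v : A) : A := v 0 j *: delta_mx 0 j.
Lemma proj_linear j : linear (proj_fun j).
Proof. by move=> a u v; rewrite /proj_fun !mxE scalerDl scalerA. Qed.
HB.instance Definition _ j :=
  GRing.isLinear.Build K A A _ (proj_fun j) (proj_linear j).
Definition proj j : {linear A -> A} := proj_fun j.

Lemma proj_freeW j b : subS (freeW b) (preS (proj j) (freeW b)).
Proof.
move=> v h l /=; rewrite /proj_fun !mxE eqxx /=; case: (eqVneq l j) => [->|_].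
  by rewrite mulr1; apply: h.
by rewrite mulr0 eqxx.
Qed.

(** The trace on the j-th coordinate axis of the component of degree c.  The
    Koszul complex of a free module is the direct sum of those of the axes. *)
Definition lineW j c := capS (freeW c) (imS (proj j) (fullS A)).

Lemma kmap_proj_chain j c ds m i z :
  chain m (map freeW ds) (freeW c) i z ->
  chain m (map freeW ds) (lineW j c) i (kmap (proj j) m z).
Proof.
apply: kmap_chain; first exact: proj_freeW.
by move=> v h; split; [apply: proj_freeW | exists v].
Qed.

Lemma kmap_proj_sum m (z : kosz A m) : z = \sum_j kmap (proj j) m z.
Proof.
elim: m z => [|m IHm] z.
  rewrite [LHS]row_sum_delta; apply: eq_bigr => j _; by rewrite kmap0.
rewrite [LHS]surjective_pairing [RHS]surjective_pairing.
rewrite (raddf_sum fst) (raddf_sum snd) /=; congr pair.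
  by rewrite [LHS]IHm; apply: eq_bigr => j _; rewrite kmapS.
by rewrite [LHS]IHm; apply: eq_bigr => j _; rewrite kmapS.
Qed.

Lemma lineW_coord j c v l : lineW j c v -> l != j -> v 0 l = 0.
Proof.
by move=> [_ [w _ <-]] lj; rewrite /= /proj_fun !mxE eqxx (negPf lj) mulr0.
Qed.

Lemma lineW_zero j c : ~~ led (d j) c -> subS (lineW j c) (zeroS A).
Proof.
move=> dj v h; have [h1 _] := h; apply/rowP => l; rewrite mxE.
case: (eqVneq l j) => [->|/(lineW_coord h) //].
by apply/eqP; apply: contraNT dj => /h1.
Qed.

(** If [d j] is not below [c], the axis contributes 0.  If it is strictly below,
    some [c - dunit k] is still above [d j], so the whole axis lies in a face. *)
Lemma lineW_acyclic j c : d j <> c -> acyclic n (map freeW (faces c)) (lineW j c).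
Proof.
move=> djc; have [le|] := boolP (led (d j) c); last first.
  by move=> /lineW_zero; apply: acyclic_zero.
have [k lt] : exists k, d j k < c k.
  apply/existsP; rewrite -[X in is_true X]negbK; apply/negP.
  rewrite negb_exists => /forallP h; apply: djc; apply/ffunP => k.
  by apply/le_anti; rewrite (forallP le) leNgt h.
apply: (acyclic_sub (y := freeW (c - dunit k))).
- rewrite -map_comp; have : k \in enum 'I_n by rewrite mem_enum.
  elim: (enum _) => //= x s IHs; rewrite inE => /orP[/eqP ->|/IHs]; [by left | by right].
- by rewrite size_map size_faces.
move=> v h l vl; have /eqP -> : l == j.
  by apply: contraNT vl => /(lineW_coord h) ->.
apply/forallP => k'; rewrite !ffunE; case: eqVneq => [->|_] /=.
  by lia.
by rewrite subr0 (forallP le).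
Qed.

Lemma lineW_faces j c y : d j = c -> List.In y (map freeW (faces c)) ->
  subS (capS (lineW j c) y) (zeroS A).
Proof.
move=> djc yf v [h yv]; apply/rowP => l; rewrite mxE.
case: (eqVneq l j) => [->|/(lineW_coord h) //].
have [k yk] : exists k, y = freeW (c - dunit k).
  move: yf; rewrite /faces -map_comp; elim: (enum _) => //= x s IHs [<-|/IHs //].
  by exists x.
apply/eqP; apply/negPn/negP => vj; have := yv; rewrite yk => /(_ _ vj).
by move=> /forallP/(_ k); rewrite djc !ffunE eqxx /=; lia.
Qed.

(** A cycle is the sum of its projections to the axes, and the axes of degree
    other than [c] have exact complexes. *)
Lemma free_bounds c i z :
  cycles n (map freeW (faces c)) (freeW c) i z ->
  (forall j, d j = c -> kmap (proj j) n z = 0) ->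
  bounds n (map freeW (faces c)) (freeW c) i z.
Proof.
move=> [Wz dz] z0; rewrite [z]kmap_proj_sum; apply: sub_sum => j _.
case: (classic (d j = c)) => [/z0 ->|djc]; first exact: sub0P.
have [|w Ww dw] := @lineW_acyclic j c djc i (kmap (proj j) n z).
  by split; [apply: kmap_proj_chain | rewrite /= -kmap_kd dz linear0].
by exists w => //; apply: chain_cap Ww.
Qed.

Lemma free_proj0 c i z j : i != 0 -> d j = c ->
  chain n (map freeW (faces c)) (freeW c) i z -> kmap (proj j) n z = 0.
Proof.
move=> i0 djc Wz.
apply: (chain_faces0 (ys := map freeW (faces c)) (P := lineW j c) (i := i)) => //.
- by rewrite size_map size_faces.
- by move=> y; apply: lineW_faces.
exact: kmap_proj_chain.
Qed.

Lemma free_acyclic c i : i != 0 ->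
  subS (cycles n (map freeW (faces c)) (freeW c) i)
       (bounds n (map freeW (faces c)) (freeW c) i).
Proof.
move=> i0 z zP; apply: free_bounds => // j djc.
by apply: free_proj0 i0 djc (proj1 zP).
Qed.

(** The complex of an axis in degree [c] itself is K in homological degree 0, so
    the generators of degree [c] give a basis of the homology. *)
Lemma free_dim c : koszul_dim freeW c 0 #|[set j | d j == c]|.
Proof.
set J := [set j | d j == c].
have JP (s : 'I_#|J|) : d (enum_val s) = c.
  by have := enum_valP s; rewrite inE => /eqP.
have projd j l : proj j (delta_mx 0 l) = (j == l)%:R *: delta_mx 0 j :> A.
  by rewrite /= /proj_fun mxE eqxx.
have projs j (a : 'I_#|J| -> K) s : j = enum_val s ->
    kmap (proj j) n (\sum_s a s *: kemb A n (delta_mx 0 (enum_val s))) =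
    kemb A n (a s *: delta_mx 0 j).
  move=> js; rewrite linear_sum (bigD1 s) //= big1 => [|t ts].
    by rewrite addr0 linearZ kmap_kemb projd js eqxx scale1r linearZ.
  rewrite linearZ kmap_kemb projd js (inj_eq enum_val_inj) eq_sym (negPf ts).
  by rewrite scale0r linear0; apply: scaler0.
exists (fun s => kemb A n (delta_mx 0 (enum_val s))); split.
- move=> s; split; last exact: kd_kemb.
  apply: chain_kemb => l; rewrite mxE eqxx /=; case: (eqVneq l (enum_val s)) => [->|_].
    by rewrite JP => _; apply/forallP.
  by rewrite eqxx.
- move=> u uP; have [/chain_deg0[v Wv uv] du] := uP.
  exists (fun s => v 0 (enum_val s)); apply: free_bounds => [|j djc].
    apply: subB => //; apply: sub_sum => s _; apply: subZ.
    split; last exact: kd_kemb.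
    apply: chain_kemb => l; rewrite mxE eqxx /=; case: (eqVneq l (enum_val s)) => [->|_].
      by rewrite JP => _; apply/forallP.
    by rewrite eqxx.
  have jJ : j \in J by rewrite inE djc.
  have js := esym (enum_rankK_in jJ jJ).
  rewrite linearB (projs j _ _ js) uv kmap_kemb /= /proj_fun -js.
  by rewrite subrr.
move=> a [w Ww dw] s.
have w0 := free_proj0 (j := enum_val s) _ (JP s) Ww.
have : kmap (proj (enum_val s)) n (kd A n w) = 0 by rewrite kmap_kd w0 ?linear0.
rewrite dw (projs _ a s erefl) -[RHS](linear0 (kemb A n)) => /kemb_inj.
by move=> /rowP/(_ (enum_val s)); rewrite !mxE !eqxx mulr1.
Qed.
End Free.

(** * Resolutions by filtered spaces *)

Section FilteredResolution.
Variables (K : fieldType) (n : nat) (r : nat -> nat).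
Variables (d : forall i, 'I_(r i) -> degree n).
Variables (A : forall i, {linear 'rV[K]_(r i.+1) -> 'rV[K]_(r i)}).
Local Notation W i := (freeW K (@d i)).

(** [f] is the map from the i-th free module onto the module that it covers,
    namely the i-th syzygy, or the resolved module when [i] is 0. *)
Definition presents i (B : lmodType K) (WB : degree n -> subspace B)
    (f : {linear 'rV[K]_(r i) -> B}) :=
  [/\ filtration WB, forall c, subS (W i c) (preS f (WB c)),
   forall c, subS (WB c) (imS f (W i c)) &
   forall c v, W i c v -> (f v = 0 <-> imS (A i) (W i.+1 c) v)].

Hypothesis Ahom : forall i c, subS (W i.+1 c) (preS (A i) (W i c)).
Hypothesis Aexact : forall i c v,
  W i.+1 c v -> (A i v = 0 <-> imS (A i.+1) (W i.+2 c) v).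
Hypothesis Amin : forall i c w j, W i.+1 c w -> d j = c -> A i w 0 j = 0.

Lemma presents_ker i B (WB : degree n -> subspace B) f :
  presents (i := i) WB f -> presents (kerW f (W i)) (A i).
Proof.
move=> [WF into onto ex]; split.
- by apply: kerW_filtration; apply: freeW_filtration.
- move=> c w Ww; have Wv := Ahom Ww; split=> //.
  by apply/(ex c) => //; exists w.
- by move=> c v [Wv /(ex c v Wv)].
exact: Aexact.
Qed.

(** This is where minimality enters: in degree 0 a chain of the kernel is an
    element of the image of the next free module, so its coordinates on the
    generators of degree [c] vanish.  In other degrees free modules are acyclic. *)
Lemma ker_cycles_bounds i B (WB : degree n -> subspace B) f c j :
  presents (i := i) WB f ->
  subS (cycles n (map (kerW f (W i)) (faces c)) (kerW f (W i) c) j)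
    (bounds n (map (W i) (faces c)) (W i c) j).
Proof.
move=> [WF into onto ex] x [xP dx].
have [Wx fx] : chain n (map (W i) (faces c)) (W i c) j x /\ kmap f n x = 0.
  by apply/kmap_ker => //; [apply: freeW_filtration | apply: size_faces].
apply: free_bounds => [//|l lc].
have [j0|j0] := eqVneq j 0; last exact: free_proj0 j0 lc Wx.
move: xP; rewrite j0 => /chain_deg0[v [Wv /(ex c v Wv)[w Ww <-]] ->].
by rewrite kmap_kemb /= /proj_fun (Amin Ww lc) scale0r linear0.
Qed.

(** Koszul homology in degree j of the i-th syzygy is that of the (i + j)-th
    syzygy in degree 0, of which the generators of degree [c] of the (i + j)-th
    free module form a basis. *)
Theorem betti_koszul j i B (WB : degree n -> subspace B) f c k :
  presents (i := i) WB f -> k = (i + j)%N ->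
  koszul_dim WB c j%:Z #|[set l | @d k l == c]|.
Proof.
elim: j i B WB f => [|j IHj] i B WB f pf kE.
  rewrite {}kE addn0; have [WF into onto _] := pf.
  apply: dim_deg0 WF into onto _ (free_dim _ _ _); first exact: freeW_filtration.
  exact: ker_cycles_bounds pf.
have [WF into onto _] := pf.
rewrite intS addrC; apply: dim_shift (freeW_filtration _) WF into onto _ _ _.
- by apply: free_acyclic; lia.
- exact: ker_cycles_bounds pf.
by apply: IHj (presents_ker pf) _; rewrite kE addnS.
Qed.
End FilteredResolution.

(** * Monomials and graded modules *)

Section Monomials.
Variables (K : fieldType) (n : nat).
Local Notation S := {mpoly K[n]}.

Definition mdiff (b c : degree n) : 'X_{1..n} := [multinom `|b k - c k|%N | k < n].

Lemma mdiffK b c : led c b -> mdegree (mdiff b c) + c = b.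
Proof.
move=> /forallP le; apply/ffunP => k; rewrite !ffunE mnmE gez0_abs ?subrK //.
by rewrite subr_ge0 le.
Qed.

Lemma mdegree_inj : injective (@mdegree n).
Proof.
by move=> m m' /ffunP h; apply/mnmP => k; have := h k; rewrite !ffunE => -[].
Qed.

(** The coefficient of [p] at the Laurent monomial of exponent [b]; allowing
    negative exponents makes [zcoefMX] hold unconditionally. *)
Definition zcoef (p : S) (b : degree n) : K :=
  if led 0 b then p@_(mdiff b 0) else 0.

Lemma zcoef_mdegree p m : zcoef p (mdegree m) = p@_m.
Proof.
have le0 : led 0 (mdegree m) by apply/forallP => k; rewrite !ffunE.
rewrite /zcoef le0; congr (_ @_ _); apply: mdegree_inj.
by rewrite -{2}(mdiffK le0) addr0.
Qed.

Lemma zcoefMX p m b : zcoef ('X_[m] * p) (mdegree m + b) = zcoef p b.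
Proof.
rewrite mulrC; case: (boolP (led 0 b)) => [le0|nle0].
  have <- : mdegree (m + mdiff b 0) = mdegree m + b.
    rewrite -{2}(mdiffK le0) addr0.
    by apply/ffunP => k; rewrite !ffunE !mnmE PoszD.
  by rewrite zcoef_mdegree mcoeffMX /zcoef le0.
rewrite {2}/zcoef (negPf nle0) /zcoef; case: ifP => // le.
apply/eqP; rewrite -[_ == 0]negbK -mcoeff_msupp; apply: contra nle0.
rewrite (perm_mem (msuppMX _ _)) => /mapP[m' _ mm'].
have : mdegree (mdiff (mdegree m + b) 0) + 0 = mdegree m + b by rewrite mdiffK.
rewrite addr0 mm' => /ffunP h; apply/forallP => k; have := h k.
by rewrite !ffunE mnmE PoszD => /addrI <-.
Qed.

Lemma zcoef_linear b : forall a p q,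
  zcoef (a%:MP * p + q) b = a * zcoef p b + zcoef q b.
Proof.
move=> a p q; rewrite /zcoef; case: ifP => _; last by rewrite mulr0 addr0.
by rewrite mcoeffD mcoeffCM.
Qed.

Lemma mpolyX_dvd (M : 'X_{1..n}) (p : S) :
  (forall m, m \in msupp p -> forall k, (M k <= m k)%N) ->
  exists q, p = 'X_[M] * q.
Proof.
move=> h; exists (\sum_(m <- msupp p) p@_m *: 'X_[m - M]).
rewrite {1}[p]mpolyE mulr_sumr [LHS]big_seq [RHS]big_seq.
apply: eq_bigr => m /h le.
rewrite -scalerAr -mpolyXD addmC submK //.
by apply/mnm_lepP.
Qed.

End Monomials.

Section GradedModule.
Variables (K : fieldType) (n : nat) (E : gmodule K n).

Lemma homogX m c u : ghomog c u -> ghomog (mdegree m + c) ('X_[K, m] *: u : E).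
Proof. by apply: ghomogM => m'; rewrite msuppX inE => /eqP ->. Qed.

Lemma homogZ a c u : ghomog c u -> ghomog c (a%:MP *: u : E).
Proof.
move=> hu; rewrite -[c]add0r; apply: ghomogM hu => m.
rewrite msuppC; case: ifP => // _; rewrite inE => /eqP ->.
by apply/ffunP => j; rewrite !ffunE mnm0E.
Qed.

Lemma homogN c u : ghomog c u -> ghomog c (- u : E).
Proof. by move=> /(homogZ (-1)); rewrite mpolyCN scaleN1r. Qed.

(** Repeated degrees are merged and [c] is added with a zero component if needed,
    so that independence of the components can be applied at [c]. *)
Lemma homog_decomp (c : degree n) (u : E) :
  exists (s : seq (degree n)) (h : degree n -> E),
  [/\ uniq s, c \in s, forall b, ghomog b (h b) & u = \sum_(b <- s) h b].
Proof.
have [s [h [hh ->]]] := ghomog_sum u.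
pose g b := iterop (count_mem b s) +%R (h b) 0.
have gh b : ghomog b (g b).
  rewrite /g; case: (count _ _) => [|k] /=; first exact: ghomog0.
  by elim: k => //= k IHk; apply: ghomogD.
have -> : \sum_(b <- s) h b = \sum_(b <- undup s) g b by rewrite big_undup_iterop_count.
case: (boolP (c \in s)) => cs.
  by exists (undup s), g; split; rewrite ?undup_uniq ?mem_undup.
exists (c :: undup s), (fun b => if b == c then 0 else g b); split.
- by rewrite /= mem_undup cs undup_uniq.
- by rewrite inE eqxx.
- by move=> b; case: eqP => [->|_]; [apply: ghomog0 | apply: gh].
rewrite big_cons eqxx add0r [LHS]big_seq [RHS]big_seq; apply: eq_bigr => b.
by rewrite mem_undup; case: eqP => // ->; rewrite (negPf cs).
Qed.

(** The component of degree [c] of the quotient [u0] already does the job, since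
    the other components are killed by the monomial. *)
Lemma homog_divide M c (u0 u : E) :
  ghomog (mdegree M + c) u -> 'X_[M] *: u0 = u ->
  exists2 w : E, ghomog c w & 'X_[M] *: w = u.
Proof.
move=> hu Mu0; have [s [h [us cs hh u0E]]] := homog_decomp c u0.
exists (h c) => //; apply/eqP; rewrite -subr_eq0; apply/eqP.
pose H d := 'X_[M] *: h (d - mdegree M) - (if d == mdegree M + c then u else 0).
suff : H (mdegree M + c) = 0 by rewrite /H eqxx [_ + c]addrC addrK.
apply: (@ghomog_indep K n E [seq mdegree M + b | b <- s]).
- by rewrite map_inj_uniq //; apply: addrI.
- move=> d; apply: ghomogD.
    by have := homogX M (hh (d - mdegree M)); rewrite addrC subrK.
  by apply: homogN; case: eqP => [->|_] //; apply: ghomog0.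
- rewrite big_map sumrB -[RHS](subrr u); congr (_ - _).
    rewrite -[RHS]Mu0 u0E scaler_sumr; apply: eq_bigr => b _.
    by rewrite addrC addKr.
  rewrite (bigD1_seq c) //= eqxx big1 ?addr0 // => b bc.
  by rewrite (inj_eq (addrI _)) (negPf bc).
by rewrite map_f.
Qed.
End GradedModule.

(** * Klyachko filtrations of a reflexive module *)

Section Klyachko.
Variables (K : fieldType) (n : nat) (E : gmodule K n).
Hypothesis Erefl : reflexive_module E.
Variables (V : vectType K) (iota : degree n -> E -> V).
Hypothesis Vcolim : is_colimit iota.

Let iotaD c (a : K) (u v : E) : ghomog c u -> ghomog c v ->
  iota c (a%:MP *: u + v) = a *: iota c u + iota c v.
Proof. by case: Vcolim => -[h _] _; apply: h. Qed.

Let iotaM c m (u : E) : ghomog c u -> iota (mdegree m + c) ('X_[m] *: u) = iota c u.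
Proof. by case: Vcolim => -[_ h] _; apply: h. Qed.

Lemma iota0 c : iota c 0 = 0.
Proof.
have := iotaD 1 (ghomog0 E c) (ghomog0 E c).
rewrite scaler0 addr0 scale1r => h.
by apply: (@addrI _ (iota c 0)); rewrite addr0.
Qed.

Lemma iotaB c u v : ghomog c u -> ghomog c v -> iota c (v - u) = iota c v - iota c u.
Proof.
move=> hu hv; have := iotaD (-1) hu hv.
by rewrite mpolyCN !scaleN1r addrC => ->; rewrite addrC.
Qed.

Lemma reflexive_eq0 (u : E) :
  (forall f : {linear E -> {mpoly K[n]}^o}, f u = 0) -> u = 0.
Proof. by case: Erefl => h _; apply: h. Qed.

(** If [u] were nonzero, some linear form [f] and some monomial of [f u] would not
    vanish.  Reading off the coefficient of the correspondingly shifted monomial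
    of [f w], for w in any component, is a cocone; it factors through the colimit
    and takes a nonzero value at [u]. *)
Lemma iota_eq0 c u : ghomog c u -> iota c u = 0 -> u = 0.
Proof.
move=> hu iu; apply: reflexive_eq0 => f; apply/eqP; apply/negPn/negP => fu.
have [m0 m0P] : exists m, m \in msupp (f u : {mpoly K[n]}).
  case E1: (msupp (f u : {mpoly K[n]})) => [|m s]; last by exists m; rewrite inE eqxx.
  by move: fu; rewrite -msupp_eq0 E1.
(* the shift is chosen so that psi c u is the coefficient of f u at m0 *)
pose psi c' (w : E) : K^o := zcoef (f w) (c' - c + mdegree m0).
have [|h [hP _]] := (proj2 Vcolim) _ psi.
  split=> [c' a x y _ _|c' m x _].
    by rewrite /psi linearP; apply: zcoef_linear.
  by rewrite /psi linearZ -!addrA; apply: zcoefMX.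
have := hP c u hu; rewrite iu linear0 /psi subrr add0r zcoef_mdegree => /esym/eqP.
by move: m0P; rewrite mcoeff_msupp => /negPf ->.
Qed.

Lemma component_subproof c a (x y : V) :
  (exists2 u, ghomog c u & x = iota c u) -> (exists2 u, ghomog c u & y = iota c u) ->
  exists2 u, ghomog c u & a *: x + y = iota c u.
Proof.
move=> [u hu ->] [w hw ->]; exists (a%:MP *: u + w); last by rewrite iotaD.
by apply: ghomogD => //; apply: homogZ.
Qed.

(** The image W_c of the component E_c in the colimit. *)
Definition component c : subspace (V : lmodType K) :=
  @Subspace K V (fun v => exists2 u, ghomog c u & v = iota c u)
    (ex_intro2 _ _ 0 (ghomog0 E c) (esym (iota0 c))) (@component_subproof c).

Lemma component_le c b v : led c b -> component c v -> component b v.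
Proof.
move=> le [u hu ->]; exists ('X_[mdiff b c] *: u).
  by have := homogX (mdiff b c) hu; rewrite mdiffK.
by rewrite -(iotaM (mdiff b c) hu) mdiffK.
Qed.

Lemma mem_klyachko k i v :
  v \in klyachko iota k i <-> exists2 c : degree n, c k = i & component c v.
Proof.
rewrite klyachkoP; last by case: Vcolim.
split=> [[c [u [ck hu ->]]]|[c ck [u hu ->]]].
  by exists c => //; exists u.
by exists c, u.
Qed.

Lemma klyachko_mono k i j : i <= j -> (klyachko iota k i <= klyachko iota k j)%VS.
Proof.
move=> ij; apply/subvP => v /mem_klyachko[c ck cv]; apply/mem_klyachko.
exists [ffun l => if l == k then j else c l]; first by rewrite ffunE eqxx.
apply: component_le cv; apply/forallP => l; rewrite ffunE; case: eqP => // ->.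
by rewrite ck.
Qed.

(** Let v be in all E^k(c_k).  After moving up to a large degree C, v is the image
    of a single u in E_C, and for every k, u is a multiple of a monomial whose
    exponent at k is C_k - c_k.  So for every linear form f, x^(C - c) divides
    f u.  The quotients define an element of the bidual, and by reflexivity u is
    divisible by x^(C - c) in E. *)
Lemma componentP (hn : (0 < n)%N) c v :
  component c v <-> forall k, v \in klyachko iota k (c k).
Proof.
split=> [cv k|h]; first by apply/mem_klyachko; exists c.
have /fin_all_exists2[ck ckk ckv] k : exists2 b : degree n, b k = c k & component b v.
  by apply/mem_klyachko.
(* any degree above c and all the ck k would do *)
pose C : degree n := [ffun j => (maxn `|c j| (\max_k `|ck k j|))%N%:Z].
have cC : led c C by apply/forallP => j; rewrite ffunE; lia.
have ckC k : led (ck k) C.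
  apply/forallP => j; rewrite ffunE.
  by have := @leq_bigmax _ (fun k => `|ck k j|%N) k; lia.
have [u hu uv] := component_le (ckC (Ordinal hn)) (ckv _).
pose M := mdiff C c.
have uk k : exists w, u = 'X_[mdiff C (ck k)] *: w.
  have [w hw vw] := ckv k; exists w; apply/eqP; rewrite -subr_eq0; apply/eqP.
  have hXw : ghomog C ('X_[mdiff C (ck k)] *: w).
    by have := homogX (mdiff C (ck k)) hw; rewrite mdiffK.
  apply: (@iota_eq0 C); first by apply: ghomogD => //; apply: homogN.
  rewrite iotaB // -uv -{1}(mdiffK (ckC k)) iotaM // vw subrr //.
have Mdvd (f : {linear E -> {mpoly K[n]}^o}) :
    exists q : {mpoly K[n]}, f u = 'X_[M] * q.
  apply: mpolyX_dvd => m mf k; have [w uw] := uk k.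
  move: mf; rewrite uw linearZ /= -[_ *: _]/('X_[_] * _) mulrC.
  rewrite (perm_mem (msuppMX _ _)) => /mapP[m' _ ->].
  by rewrite mnmDE !mnmE ckk leq_addr.
(* theta f is the polynomial f u / x^(C - c) *)
pose theta f := proj1_sig (constructive_indefinite_description _ (Mdvd f)).
have thetaP (f : {linear E -> {mpoly K[n]}^o}) : f u = 'X_[M] * theta f.
  exact: proj2_sig (constructive_indefinite_description _ (Mdvd f)).
have X0 : 'X_[M] != 0 :> {mpoly K[n]} by rewrite -msupp_eq0 msuppX.
have [|u0 u0P] := (proj2 Erefl) theta.
  move=> a f g k fgk; apply: (mulfI X0).
  by rewrite -thetaP fgk !thetaP mulrDr mulrCA.
have Mu0 : 'X_[M] *: u0 = u.
  apply/eqP; rewrite -subr_eq0; apply/eqP; apply: reflexive_eq0 => f.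
  by rewrite linearB linearZ /= -u0P thetaP subrr.
have [|w hw wu] := homog_divide (M := M) (c := c) _ Mu0; first by rewrite mdiffK.
by exists w => //; rewrite -(iotaM M hw) wu mdiffK.
Qed.

Lemma component_filtration (hn : (0 < n)%N) : filtration component.
Proof.
move=> b c v; split=> [cv|[/(componentP hn) hb /(componentP hn) hc]].
  by split; apply: component_le cv; apply/forallP => k; rewrite ffunE; lia.
by apply/(componentP hn) => k; rewrite ffunE minElt; case: ifP.
Qed.

(** The union of the images is a subspace U.  The identity of V and a projection
    onto U agree on the images of the components, so they are equal by
    uniqueness in the universal property. *)
Lemma component_cover v : exists c, component c v.
Proof.
have [|a x y [b bx] [c cy]|U UP] := @vspace_of_closed K V (fun v => exists c, component c v).
- by exists 0; apply: sub0P.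
- exists [ffun k => Num.max (b k) (c k)].
  by apply: subLP; [apply: component_le bx | apply: component_le cy];
    apply/forallP => k; rewrite ffunE; lia.
have [h [_ hU]] := (proj2 Vcolim) _ iota (proj1 Vcolim).
apply/UP; rewrite (_ : v = projv U v) ?memv_proj //.
transitivity (h v).
  by apply: (hU idfun).
symmetry; apply: (hU (projv U)) => c u hu; apply: projv_id.
by apply/UP; exists c, u.
Qed.

Lemma klyachko_full (k : 'I_n) (X : {vspace V}) :
  exists i, (X <= klyachko iota k i)%VS.
Proof.
have /fin_all_exists[c cP] (j : 'I_(\dim X)) := component_cover (vbasis X)`_j.
exists ((\max_j `|c j k|)%N%:Z).
rewrite -[X in (X <= _)%VS](span_basis (vbasisP X)).
apply/span_subvP => v /(nthP 0)[j jlt <-]; rewrite size_tuple in jlt.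
have := cP (Ordinal jlt) => cv.
apply: (subvP (klyachko_mono k _)); last by apply/mem_klyachko; exists (c (Ordinal jlt)).
by have := @leq_bigmax _ (fun j => `|c j k|%N) (Ordinal jlt); lia.
Qed.

End Klyachko.

(** * Setting all variables equal to one *)

Section Evaluation.
Variables (K : fieldType) (n : nat).
Local Notation S := {mpoly K[n]}.

Definition ev1 (p : S) : K := p.@[fun=> 1].

Lemma ev1X m : ev1 'X_[m] = 1.
Proof. by rewrite /ev1 mevalX big1 // => i _; rewrite expr1n. Qed.

Lemma homog_monomial b (p : S) :
  mpoly_homog b p -> p = ev1 p *: 'X_[mdiff b 0] /\ (p != 0 -> led 0 b).
Proof.
move=> hp; have [->|p0] := eqVneq p 0; first by rewrite /ev1 meval0 scale0r.
have [m mp] : exists m, m \in msupp p.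
  case E1: (msupp p) => [|m s]; last by exists m; rewrite inE eqxx.
  by move: p0; rewrite -msupp_eq0 E1.
have mb := hp m mp.
have le0 : led 0 b by rewrite -mb; apply/forallP => k; rewrite !ffunE.
have -> : mdiff b 0 = m.
  by apply: (@mdegree_inj n); rewrite mb -{2}(mdiffK le0) addr0.
split=> //; have pE : p = p@_m *: 'X_[m].
  apply/mpolyP => m'; rewrite mcoeffZ mcoeffX.
  have [<-|mm'] := eqVneq m m'; first by rewrite mulr1.
  rewrite mulr0; apply: memN_msupp_eq0; apply/negP => /hp m'b.
  by case/eqP: mm'; apply: (@mdegree_inj n); rewrite m'b.
by rewrite {1}pE {2}pE /ev1 mevalZ -/(ev1 _) ev1X mulr1.
Qed.

Section Lift.
Variables (r : nat) (d : 'I_r -> degree n).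

(** On homogeneous elements of a given degree this is injective, with inverse
    [homog_lift]: a homogeneous polynomial is a multiple of one monomial. *)
Definition evr (v : 'rV[S]_r) : 'rV[K]_r := map_mx ev1 v.

Definition homog_lift (c : degree n) (w : 'rV[K]_r) : 'rV[S]_r :=
  \row_j (w 0 j *: 'X_[mdiff (c - d j) 0]).

Lemma lift_homog c w : freeW K d c w -> free_homog d c (homog_lift c w).
Proof.
move=> Ww j m; rewrite mxE; have [->|wj] := eqVneq (w 0 j) 0.
  by rewrite scale0r msupp0.
move/msuppZ_le; rewrite msuppX inE => /eqP ->.
have le : led 0 (c - d j).
  by apply/forallP => k; have /forallP/(_ k) := Ww j wj; rewrite !ffunE subr_ge0.
by rewrite -{2}(mdiffK le) addr0.
Qed.

Lemma evr_lift c w : evr (homog_lift c w) = w.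
Proof. by apply/rowP => j; rewrite !mxE /ev1 mevalZ -/(ev1 _) ev1X mulr1. Qed.

Lemma evr_homog c v : free_homog d c v -> freeW K d c (evr v).
Proof.
move=> hv j; rewrite mxE => vj.
have [_ /(_ _)/forallP h] := homog_monomial (hv j).
apply/forallP => k; have := h _ k; rewrite !ffunE.
case: eqP => [v0|_ /(_ isT)]; last by rewrite subr_ge0.
by case/eqP: vj; rewrite v0 /ev1 meval0.
Qed.

Lemma lift_evr c v : free_homog d c v -> homog_lift c (evr v) = v.
Proof.
by move=> hv; apply/rowP => j; rewrite !mxE -(proj1 (homog_monomial (hv j))).
Qed.

Lemma delta_homog j : free_homog d (d j) (delta_mx 0 j : 'rV[S]_r).
Proof.
move=> l m; rewrite mxE eqxx /=; have [->|_] := eqVneq l j; last by rewrite msupp0.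
rewrite subrr msupp1 inE => /eqP ->.
by apply/ffunP => k; rewrite !ffunE mnm0E.
Qed.

Lemma free_decomp (w : 'rV[S]_r) : exists s : seq (degree n * 'rV[S]_r),
  (forall p, p \in s -> free_homog d p.1 p.2) /\ w = \sum_(p <- s) p.2.
Proof.
rewrite [w]row_sum_delta.
pose Q (w : 'rV[S]_r) := exists s : seq (degree n * 'rV[S]_r),
  (forall p, p \in s -> free_homog d p.1 p.2) /\ w = \sum_(p <- s) p.2.
have Q0 : Q 0 by exists [::]; rewrite big_nil.
have QD x y : Q x -> Q y -> Q (x + y).
  move=> [s [hs ->]] [t [ht ->]]; exists (s ++ t); rewrite big_cat; split=> // p.
  by rewrite mem_cat => /orP[/hs|/ht].
rewrite -/(Q _); apply: (big_ind Q) => // j _.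
rewrite (mpolyE (w 0 j)) scaler_suml; apply: (big_ind Q) => // m _.
exists [:: (mdegree m + d j, (w 0 j)@_m *: 'X_[m] *: delta_mx 0 j)].
rewrite big_seq1; split=> // p; rewrite inE => /eqP -> /= l m'; rewrite !mxE eqxx /=.
have [->|_] := eqVneq l j; last by rewrite mulr0 msupp0.
by rewrite mulr1 addrK => /msuppZ_le; rewrite msuppX inE => /eqP ->.
Qed.

Lemma free_indep (s : seq (degree n)) (h : degree n -> 'rV[S]_r) :
  uniq s -> (forall c, free_homog d c (h c)) -> \sum_(c <- s) h c = 0 ->
  forall c, c \in s -> h c = 0.
Proof.
move=> us hh h0 c cs; apply/rowP => j; apply/mpolyP => m; rewrite mxE mcoeff0.
have [mc|mc] := eqVneq (mdegree m) (c - d j); last first.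
  by apply: memN_msupp_eq0; apply: contra mc => /hh ->.
have /rowP/(_ j)/mpolyP/(_ m) := h0; rewrite summxE mxE mcoeff0 (raddf_sum (mcoeff m)).
rewrite (bigD1_seq c) //= big1 ?addr0 // => b bc.
apply: memN_msupp_eq0; apply: contra bc => /hh; rewrite mc => /addIr ->.
by rewrite eqxx.
Qed.

(** [G] is any grading with independent components.  The components of [w] map to
    homogeneous elements of distinct degrees with homogeneous sum, so only the
    one of degree [c] survives. *)
Lemma homog_preimage (M : zmodType) (G : degree n -> M -> Prop)
    (g : {additive 'rV[S]_r -> M}) :
  (forall c, G c 0) -> (forall c u v, G c u -> G c v -> G c (u - v)) ->
  (forall (s : seq (degree n)) (h : degree n -> M),
    uniq s -> (forall c, G c (h c)) -> \sum_(c <- s) h c = 0 ->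
    forall c, c \in s -> h c = 0) ->
  (forall c v, free_homog d c v -> G c (g v)) ->
  forall c w, G c (g w) -> exists2 w', free_homog d c w' & g w' = g w.
Proof.
move=> G0 GB Gind gG c w Gw; have [s [hs wE]] := free_decomp w.
pose comp b := \sum_(p <- s | p.1 == b) p.2.
have fhD b x y : free_homog d b x -> free_homog d b y -> free_homog d b (x + y).
  move=> hx hy j m; rewrite mxE => /msuppD_le; rewrite mem_cat.
  by case/orP; [apply: hx | apply: hy].
have hcomp b : free_homog d b (comp b).
  rewrite /comp big_seq_cond; apply: big_ind.
  - by move=> j m; rewrite mxE msupp0.
  - exact: fhD.
  by move=> p /andP[ps /eqP <-]; apply: hs.
pose t := undup (c :: map fst s).
have wcomp : w = \sum_(b <- t) comp b.
  rewrite wE /comp; under [RHS]eq_bigr do rewrite big_mkcond.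
  rewrite exchange_big /= big_seq [RHS]big_seq; apply: eq_bigr => p ps.
  have pt : p.1 \in t by rewrite mem_undup inE map_f ?orbT.
  rewrite (bigD1_seq p.1) ?undup_uniq //= eqxx big1 ?addr0 // => b.
  by rewrite eq_sym => /negPf ->.
exists (comp c) => //; apply/eqP; rewrite -subr_eq0; apply/eqP.
pose h b := g (comp b) - (if b == c then g w else 0).
suff : h c = 0 by rewrite /h eqxx.
have ct : c \in t by rewrite mem_undup inE eqxx.
apply: (Gind t h) => //; first exact: undup_uniq.
  by move=> b; apply: GB; [apply: gG | case: eqP => [->|]].
rewrite sumrB -raddf_sum -wcomp (bigD1_seq c) ?undup_uniq //= eqxx big1 ?addr0 ?subrr //.
by move=> b /negPf ->.
Qed.
End Lift.

Lemma evr_linear a b (g : {linear 'rV[S]_a -> 'rV[S]_b}) v :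
  evr (g v) = \sum_j ev1 (v 0 j) *: evr (g (delta_mx 0 j)).
Proof.
rewrite {1}[v]row_sum_delta linear_sum; apply/rowP => l.
rewrite mxE summxE summxE /ev1 rmorph_sum; apply: eq_bigr => j _.
by rewrite linearZ !mxE rmorphM.
Qed.

Section Map.
Variables (a b : nat) (g : {linear 'rV[S]_a -> 'rV[S]_b}).

(** The map induced by [g] on the spaces obtained by setting all variables to 1. *)
Definition ev_map_fun (w : 'rV[K]_a) : 'rV[K]_b :=
  \sum_j w 0 j *: evr (g (delta_mx 0 j)).
Lemma ev_map_linear : linear ev_map_fun.
Proof.
move=> x u v; rewrite /ev_map_fun scaler_sumr -big_split /=; apply: eq_bigr => j _.
by rewrite !mxE scalerDl scalerA.
Qed.
HB.instance Definition _ :=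
  GRing.isLinear.Build K 'rV[K]_a 'rV[K]_b _ ev_map_fun ev_map_linear.
Definition ev_map : {linear 'rV[K]_a -> 'rV[K]_b} := ev_map_fun.

Lemma evr_map v : evr (g v) = ev_map (evr v).
Proof.
by rewrite evr_linear; apply: eq_bigr => j _; rewrite mxE.
Qed.

End Map.
End Evaluation.

(** * Betti numbers as Koszul homology *)

Section Transfer.
Variables (K : fieldType) (n : nat) (hn : (0 < n)%N) (E : gmodule K n).
Hypothesis Erefl : reflexive_module E.
Variables (V : vectType K) (iota : degree n -> E -> V).
Hypothesis Vcolim : is_colimit iota.
Variable F : min_resolution E.
Local Notation S := {mpoly K[n]}.
Local Notation d i := (@res_deg K n E F i).
Local Notation W := (component Vcolim).

(** The augmentation F_0 -> E read in V, with all variables set to 1. *)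
Definition aug_fun (w : 'rV[K]_(res_rank F 0)) : V :=
  \sum_j w 0 j *: iota (d 0 j) (res_aug F (delta_mx 0 j)).
Lemma aug_linear : linear aug_fun.
Proof.
move=> x u v; rewrite /aug_fun scaler_sumr -big_split /=; apply: eq_bigr => j _.
by rewrite !mxE scalerDl scalerA.
Qed.
HB.instance Definition _ := GRing.isLinear.Build K _ V _ aug_fun aug_linear.

Lemma iota_sum c (I : finType) (u : I -> E) :
  (forall i, ghomog c (u i)) -> iota c (\sum_i u i) = \sum_i iota c (u i).
Proof.
move=> hu; pose Q (x : E) (y : V) := ghomog c x /\ iota c x = y.
suff : Q (\sum_i u i) (\sum_i iota c (u i)) by case.
apply: big_rec2 => [|i x y _ [hx <-]].
  by split; [apply: ghomog0 | apply: iota0].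
split; first exact: ghomogD.
have [[iD _] _] := Vcolim; have := iD c 1 _ _ (hu i) hx.
by rewrite mpolyC1 !scale1r.
Qed.

Lemma aug_iota c v : free_homog (d 0) c v ->
  iota c (res_aug F v) = aug_fun (evr v).
Proof.
move=> hv; rewrite {1}[v]row_sum_delta linear_sum iota_sum; last first.
  move=> j; rewrite linearZ /= -[c](subrK (d 0 j)).
  by apply: ghomogM; [apply: hv | apply: res_aug_homog; apply: delta_homog].
apply: eq_bigr => j _; rewrite linearZ mxE /=.
have [vE vled] := homog_monomial (hv j).
have [v0|/vled le0] := eqVneq (v 0 j) 0.
  by rewrite v0 scale0r (iota0 Vcolim) /ev1 meval0 scale0r.
have hd : ghomog (d 0 j) (res_aug F (delta_mx 0 j)).
  by apply: res_aug_homog; apply: delta_homog.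
have [[iD iM] _] := Vcolim.
have cE : mdegree (mdiff (c - d 0 j) 0) + d 0 j = c.
  by rewrite -[mdegree _]addr0 mdiffK // subrK.
rewrite {1}vE -mul_mpolyC -scalerA -[X in iota c X]addr0 iD.
- by rewrite (iota0 Vcolim) addr0 -{1}cE iM.
- by rewrite -{1}cE; apply: homogX.
exact: ghomog0.
Qed.

Lemma ghomogB c (u v : E) : ghomog c u -> ghomog c v -> ghomog c (u - v).
Proof. by move=> hu hv; apply: ghomogD => //; apply: homogN. Qed.

Lemma aug_homog_preimage c w : ghomog c (res_aug F w) ->
  exists2 w', free_homog (d 0) c w' & res_aug F w' = res_aug F w.
Proof.
apply: homog_preimage.
- exact: ghomog0.
- exact: ghomogB.
- exact: ghomog_indep.
exact: res_aug_homog.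
Qed.

Lemma free_homog0 r (e : 'I_r -> degree n) c : free_homog e c (0 : 'rV[S]_r).
Proof. by move=> j m; rewrite mxE msupp0. Qed.

Lemma free_homogB r (e : 'I_r -> degree n) c (u v : 'rV[S]_r) :
  free_homog e c u -> free_homog e c v -> free_homog e c (u - v).
Proof.
move=> hu hv j m; rewrite !mxE => /msuppB_le; rewrite mem_cat.
by case/orP; [apply: hu | apply: hv].
Qed.

Lemma map_homog_preimage i c w : free_homog (d i) c (res_map F i w) ->
  exists2 w', free_homog (d i.+1) c w' & res_map F i w' = res_map F i w.
Proof.
apply: homog_preimage.
- exact: free_homog0.
- exact: free_homogB.
- exact: free_indep.
exact: res_map_homog.
Qed.

Definition resA i : {linear 'rV[K]_(res_rank F i.+1) -> 'rV[K]_(res_rank F i)} :=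
  ev_map (res_map F i).

Lemma resA_lift i c w : freeW K (d i.+1) c w ->
  free_homog (d i) c (res_map F i (homog_lift (d i.+1) c w)) /\
  evr (res_map F i (homog_lift (d i.+1) c w)) = resA i w.
Proof.
move=> Ww; split; first by apply: res_map_homog; apply: lift_homog.
by rewrite evr_map evr_lift.
Qed.

Lemma resA_homog i c : subS (freeW K (d i.+1) c) (preS (resA i) (freeW K (d i) c)).
Proof. by move=> w /resA_lift[h] /= <-; apply: evr_homog. Qed.

Lemma evr_eq0 r (e : 'I_r -> degree n) c (v : 'rV[S]_r) :
  free_homog e c v -> evr v = 0 -> v = 0.
Proof.
move=> hv v0; rewrite -(lift_evr hv) v0; apply/rowP => j.
by rewrite !mxE scale0r.
Qed.

Lemma resA_image i c v : freeW K (d i) c v ->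
  (exists w, res_map F i w = homog_lift (d i) c v) <-> imS (resA i) (freeW K (d i.+1) c) v.
Proof.
move=> Wv; split=> [[w wv]|[w Ww <-]].
  have [|w' hw' w'w] := @map_homog_preimage i c w; first by rewrite wv; apply: lift_homog.
  exists (evr w'); first exact: evr_homog.
  by rewrite -evr_map w'w wv evr_lift.
have [h h'] := resA_lift Ww.
by exists (homog_lift (d i.+1) c w); rewrite -h' lift_evr.
Qed.

Lemma resA_exact i c v : freeW K (d i.+1) c v ->
  (resA i v = 0 <-> imS (resA i.+1) (freeW K (d i.+2) c) v).
Proof.
move=> Wv; rewrite -resA_image // -res_exact; have [h h'] := resA_lift Wv.
split=> [v0|h0]; first by apply: (evr_eq0 h); rewrite h'.
by rewrite -h' h0; apply/rowP => j; rewrite !mxE /ev1 meval0.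
Qed.

Lemma resA_minimal i c w j : freeW K (d i.+1) c w -> d i j = c -> resA i w 0 j = 0.
Proof.
move=> Ww jc; have [h <-] := resA_lift Ww; rewrite mxE.
have := h j; rewrite jc subrr => /homog_monomial[pE _].
have := @res_minimal K n E F i (homog_lift (d i.+1) c w) j; rewrite pE mcoeffZ mcoeffX.
have -> : mdiff 0 0 = 0%MM :> 'X_{1..n} by apply/mnmP => k; rewrite mnmE mnm0E subrr.
by rewrite eqxx mulr1 => ->; rewrite scale0r /ev1 meval0.
Qed.

(** Homogeneous elements have homogeneous preimages, so surjectivity and exactness
    hold in each degree, hence for the filtered spaces; injectivity of the maps
    E_c -> V makes the kernel computed in V the right one. *)
Lemma aug_presents : @presents K n (res_rank F) (@res_deg K n E F) resA 0 V W aug_fun.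
Proof.
split.
- exact: component_filtration.
- move=> c w Ww; have hl := lift_homog Ww.
  exists (res_aug F (homog_lift (d 0) c w)); first exact: res_aug_homog.
  by rewrite aug_iota // evr_lift.
- move=> c v [u hu ->]; have [w wu] := res_aug_surj F u.
  have [|w' hw' w'u] := @aug_homog_preimage c w; first by rewrite wu.
  exists (evr w'); first exact: evr_homog.
  by rewrite -wu -w'u (aug_iota hw').
move=> c v Wv; rewrite -resA_image // -res_exact0.
have hl := lift_homog Wv; have := aug_iota hl; rewrite evr_lift => augE.
split=> [v0|h0]; last by rewrite -[LHS]augE h0; apply: (iota0 Vcolim).
apply: (iota_eq0 Erefl Vcolim); first by apply: res_aug_homog; apply: hl.
exact: etrans augE v0.
Qed.

Theorem betti_koszul_dim i c : koszul_dim W c i%:Z (betti F i c).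
Proof.
exact: (@betti_koszul K n (res_rank F) (@res_deg K n E F) resA resA_homog
  resA_exact resA_minimal i 0 V W aug_fun c i aug_presents erefl).
Qed.

(** The generators of F_0 bound from below the degrees of the nonzero components;
    this is what makes the minimum over jumps exist. *)
Lemma component_lower c v : W c v -> v <> 0 -> exists j, led (d 0 j) c.
Proof.
have [_ _ onto _] := aug_presents; move=> /onto[w Ww wv] v0.
case: (classic (exists j, w 0 j != 0)) => [[j /Ww wj]|nw]; first by exists j.
case: v0; rewrite -wv (_ : w = 0) ?linear0 //; apply/rowP => j; rewrite mxE.
by apply/eqP/negPn/negP => wj; apply: nw; exists j.
Qed.
End Transfer.

(** * The arrangement and its embedding *)

Lemma memv_bigcap_seq (K : fieldType) (V : vectType K) (I : eqType) (s : seq I)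
    (U : I -> {vspace V}) v :
  v \in (\bigcap_(p <- s) U p)%VS <-> forall p, p \in s -> v \in U p.
Proof.
elim: s => [|p s IHs]; first by rewrite big_nil memvf.
rewrite big_cons memv_cap; split=> [/andP[vp /IHs vs] q|h].
  by rewrite inE => /orP[/eqP ->|/vs].
apply/andP; split; first by apply: h; rewrite inE eqxx.
by apply/IHs => q qs; apply: h; rewrite inE qs orbT.
Qed.

Lemma hdim_ext (K : fieldType) (A : lmodType K) m ys (P Q : subspace A) i d :
  subS P Q -> subS Q P -> hdim m ys P i d <-> hdim m ys Q i d.
Proof.
move=> PQ QP; apply: (@qdim_map _ _ _ _ _ _ _ idfun).
- by move=> z [Pz dz]; split=> //; apply: (chain_sub PQ).
- move=> z [Qz dz]; exists z; last by rewrite subrr; apply: sub0P.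
  by split=> //; apply: (chain_sub QP).
move=> z _; split=> -[w Pw dw]; exists w => //.
  exact: (chain_sub PQ).
exact: (chain_sub QP).
Qed.

Section Embedding.
Variables (K : fieldType) (n : nat) (hn : (0 < n)%N) (E : gmodule K n).
Hypothesis Erefl : reflexive_module E.
Variables (V : vectType K) (iota : degree n -> E -> V).
Hypothesis Vcolim : is_colimit iota.
Variable F : min_resolution E.
Local Notation W := (component Vcolim).
Local Notation Ek := (klyachko iota).
Local Notation emb := (embedding iota).

Lemma klyachko_bounded k : exists b, forall i, Ek k i != 0%VS -> b <= i.
Proof.
exists (- (\max_j `|@res_deg K n E F 0 j k|)%N%:Z) => i Ei.
have : vpick (Ek k i) != 0 by rewrite vpick0.
have /(mem_klyachko Vcolim)[c ck cv] := memv_pick (Ek k i).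
move=> /eqP v0; have [j /forallP/(_ k)] := component_lower hn Erefl F cv v0.
rewrite ck; have := @leq_bigmax _ (fun j => `|@res_deg K n E F 0 j k|%N) j; lia.
Qed.

Lemma jump_neq0 k i : is_jump iota k i -> Ek k i != 0%VS.
Proof.
move=> [le ne]; apply/eqP => E0; apply: ne; rewrite E0 subv0 in le *.
exact/eqP.
Qed.

Lemma embedding_le k (X : {vspace V}) j :
  is_jump iota k j -> (X <= Ek k j)%VS -> emb X k <= j.
Proof.
move=> jj Xj; have [b bP] := klyachko_bounded k.
rewrite ffunE.
have [|_] := @minzP (fun i => is_jump iota k i /\ (X <= Ek k i)%VS) b j _
  (conj jj Xj).
  by move=> i [/jump_neq0/bP].
by apply.
Qed.

Lemma jump_of_min k i (X : {vspace V}) :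
  (X <= Ek k i)%VS -> ~~ (X <= Ek k (i - 1))%VS -> is_jump iota k i.
Proof.
move=> Xi nXi; split; first by apply: klyachko_mono => //; lia.
by move=> eqE; move: nXi; rewrite eqE Xi.
Qed.

(** The least step of the k-th filtration that contains [X] is automatically a
    jump, since the preceding step does not contain [X]. *)
Lemma least_jump k (X : {vspace V}) : X != 0%VS ->
  exists i, [/\ is_jump iota k i, (X <= Ek k i)%VS & forall j, (X <= Ek k j)%VS -> i <= j].
Proof.
move=> X0; have [b bP] := klyachko_bounded k.
have [i Xi] := klyachko_full Vcolim k X.
have [|Xm mP] := @minzP (fun i => (X <= Ek k i)%VS : Prop) b i _ Xi.
  move=> j Xj; apply: bP; apply: contraNneq X0 => E0.
  by rewrite -subv0 -E0.
exists (minz (fun i => (X <= Ek k i)%VS : Prop)); split=> //.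
by apply: (jump_of_min Xm); apply/negP => /mP; lia.
Qed.

Lemma embedding_min k (X : {vspace V}) : X != 0%VS ->
  (X <= Ek k (emb X k))%VS /\ forall j, (X <= Ek k j)%VS -> emb X k <= j.
Proof.
move=> X0; have [i [ji Xi im]] := least_jump k X0.
have [b bP] := klyachko_bounded k.
have [||[_ Xe] _] := @minzP (fun i => is_jump iota k i /\ (X <= Ek k i)%VS) b i.
- by move=> j [/jump_neq0/bP].
- by split.
rewrite ffunE; split=> // j Xj; apply: le_trans (im j Xj).
by have := embedding_le ji Xi; rewrite ffunE.
Qed.

Lemma betti_acyclic i c :
  acyclic n (map W (faces c)) (W c) -> betti F i c = 0%N.
Proof.
by move=> ac; apply: (qdim0 (betti_koszul_dim hn Erefl Vcolim F i c)); apply: ac.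
Qed.

Lemma mem_faces k c : List.In (W (c - dunit k)) (map W (faces c)).
Proof.
rewrite /faces -map_comp; have : k \in enum 'I_n by rewrite mem_enum.
elim: (enum _) => //= x s IHs; rewrite inE => /orP[/eqP ->|/IHs]; [by left | by right].
Qed.

Lemma facesE c y : List.In y (map W (faces c)) -> exists k, y = W (c - dunit k).
Proof.
rewrite /faces -map_comp; elim: (enum _) => //= x s IHs [<-|/IHs //].
by exists x.
Qed.

Lemma component_face c k v :
  W c v -> (W (c - dunit k) v <-> v \in Ek k (c k - 1)).
Proof.
move=> /(componentP Erefl Vcolim hn) h; split=> [/(componentP Erefl Vcolim hn)/(_ k)|vk].
  by rewrite !ffunE eqxx.
apply/(componentP Erefl Vcolim hn) => l; rewrite !ffunE.
by case: eqVneq => [->|_]; rewrite ?subr0.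
Qed.

(** If some E^k(c_k - 1) contained W_c, the complex in degree [c] would
    be exact.  So all the c_k are jumps, and they are the least steps that
    contain W_c. *)
Theorem betti_in_arrangement i c : betti F i c <> 0%N ->
  exists2 X : {vspace V}, arrangement iota X & c = emb X.
Proof.
move=> bc; pose s := [seq (k, c k) | k <- enum 'I_n].
pose X := (\bigcap_(p <- s) Ek p.1 p.2)%VS.
have WX v : W c v <-> v \in X.
  rewrite memv_bigcap_seq (componentP Erefl Vcolim hn).
  split=> [h p /mapP[k _ ->] //|h k]; apply: (h (k, c k)).
  by apply: map_f; rewrite mem_enum.
have Xk k : (X <= Ek k (c k))%VS.
  by apply/subvP => v /WX/(componentP Erefl Vcolim hn).
have nXk k : ~~ (X <= Ek k (c k - 1))%VS.
  apply/negP => /subvP le; apply: bc; apply: betti_acyclic.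
  apply: (acyclic_sub (mem_faces k c)); first by rewrite size_map size_faces.
  by move=> v Wv; apply/(component_face _ Wv); apply: le; apply/WX.
have X0 : X != 0%VS by apply: contraNneq (nXk (Ordinal hn)) => ->; apply: sub0v.
have jk k : is_jump iota k (c k) by apply: jump_of_min.
exists X.
  by exists s; split=> // p /mapP[k _ ->].
apply/ffunP => k; apply/le_anti; rewrite (embedding_le (jk k) (Xk k)) andbT.
have [Xe _] := embedding_min k X0; rewrite leNgt; apply/negP => lt.
case/negP: (nXk k); apply: subv_trans Xe _.
by apply: klyachko_mono => //; rewrite lerBrDr lezD1.
Qed.

Section Facets.
Variable X : {vspace V}.
Hypothesis AX : arrangement iota X.
Local Notation c := (emb X).

Lemma component_sub_arr v : W c v -> v \in X.
Proof.
have [s [sj XE]] := AX; rewrite {2}XE => /(componentP Erefl Vcolim hn) vc.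
apply/memv_bigcap_seq => p ps; apply: (subvP (klyachko_mono Vcolim p.1 _)) (vc p.1).
apply: embedding_le; first exact: sj.
apply/subvP => w; rewrite XE => /memv_bigcap_seq; exact.
Qed.

Lemma betti_arr0 i : X = 0%VS -> betti F i c = 0%N.
Proof.
move=> X0; apply: betti_acyclic; apply: acyclic_zero => v /component_sub_arr.
by rewrite X0 memv0 => /eqP.
Qed.

Hypothesis X0 : X != 0%VS.

Lemma component_arr v : W c v <-> v \in X.
Proof.
split=> [|vX]; first exact: component_sub_arr.
apply/(componentP Erefl Vcolim hn) => k.
by have [/subvP Xe _] := embedding_min k X0; apply: Xe.
Qed.

(** Up to cofinality and zero subspaces, these are the members of the arrangement
    strictly below [X]: see [facet_arr], [facet_proper] and [facet_cofinal]. *)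
Definition facet k := (X :&: Ek k (c k - 1))%VS.

Lemma facet_component k v : v \in facet k <-> W c v /\ W (c - dunit k) v.
Proof.
rewrite memv_cap; split=> [/andP[/component_arr vX vk]|[Wv /(component_face _ Wv) vk]].
  by split=> //; apply/component_face.
by apply/andP; split=> //; apply/component_arr.
Qed.

Lemma facet_proper k : ~~ (X <= facet k)%VS.
Proof.
rewrite subv_cap subvv /=; apply/negP.
have [_ h] := embedding_min k X0; move=> /h.
by rewrite leNgt ltrBlDr ltrDl.
Qed.

Lemma facet_arr k : facet k != 0%VS -> arrangement iota (facet k).
Proof.
move=> f0; have E0 : Ek k (c k - 1) != 0%VS.
  by apply: contraNneq f0 => E0; rewrite /facet E0 capv0.
have [i [ji Ei im]] := least_jump k E0.
have [s [sj XE]] := AX; exists ((k, i) :: s); split.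
  by move=> p; rewrite inE => /orP[/eqP ->|/sj].
rewrite big_cons -XE capvC /facet; congr (_ :&: _)%VS.
apply/eqP; rewrite eqEsubv Ei /=; apply: klyachko_mono => //; exact: im.
Qed.

(** A member strictly below [X] is contained in a step E^k(i) at a jump i that
    does not contain [X], and such a step comes before the k-th coordinate of
    the degree of [X]. *)
Lemma facet_cofinal (Y : {vspace V}) :
  arrangement iota Y -> (Y <= X)%VS -> ~~ (X <= Y)%VS -> exists k, (Y <= facet k)%VS.
Proof.
move=> [s [sj YE]] YX nXY.
have [p ps nXp] : exists2 p, p \in s & ~~ (X <= Ek p.1 p.2)%VS.
  apply/hasP; apply: contraNT nXY => /hasPn h; apply/subvP => v vX.
  (* otherwise X would lie in the intersection Y *)
  rewrite YE; apply/memv_bigcap_seq => p /h; rewrite negbK => /subvP; exact.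
exists p.1; rewrite subv_cap YX /=; apply: (@subv_trans _ _ (Ek p.1 p.2)).
  by apply/subvP => v; rewrite YE => /memv_bigcap_seq; apply.
apply: klyachko_mono => //; have [Xe _] := embedding_min p.1 X0.
rewrite lerBrDr lezD1.
rewrite ltNge; apply: contra nXp => le; apply: subv_trans Xe _.
exact: klyachko_mono.
Qed.
End Facets.
End Embedding.

Theorem theorem3p27 (K : fieldType) (n : nat) (hn : (0 < n)%N)
  (E : gmodule K n)
  (Enz : exists u : E, u <> 0)
  (Efg : finitely_generated E)
  (Erefl : reflexive_module E)
  (V : vectType K) (iota : degree n -> E -> V)
  (Vcolim : is_colimit iota)
  (F : min_resolution E) :
  (forall (i : nat) (c : degree n), betti F i c <> 0%N ->
     exists2 X : {vspace V}, arrangement iota X & c = embedding iota X)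
  /\
  (forall (n' : nat) (hn' : (0 < n')%N)
     (E' : gmodule K n')
     (Enz' : exists u : E', u <> 0)
     (Efg' : finitely_generated E')
     (Erefl' : reflexive_module E')
     (V' : vectType K) (iota' : degree n' -> E' -> V')
     (Vcolim' : is_colimit iota')
     (F' : min_resolution E')
     (phi : 'Hom(V, V')),
     bijective phi ->
     maps_bijectively (fun X : {vspace V} => (phi @: X)%VS)
       (arrangement iota) (arrangement iota') ->
     forall (i : nat) (X : {vspace V}), arrangement iota X ->
       betti F i (embedding iota X)
       = betti F' i (embedding iota' (phi @: X)%VS)).
Proof.
split; first exact: (betti_in_arrangement hn Erefl Vcolim).
move=> n' hn' E' _ _ Erefl' V' iota' Vcolim' F' phi phibij [phiA phiI phiS] i X AX.
have phi_inj := bij_inj phibij.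
have memphi (U : {vspace V}) v : (phi v \in (phi @: U)%VS) = (v \in U).
  by apply/memv_imgP/idP => [[w wU /phi_inj ->] //|vU]; exists v.
have subphi (U U' : {vspace V}) : (phi @: U <= phi @: U')%VS = (U <= U')%VS.
  apply/idP/idP => [/subvP h|]; last exact: limgS.
  by apply/subvP => v; rewrite -!memphi => /h.
have [X0|X0] := eqVneq X 0%VS.
  rewrite (betti_arr0 hn Erefl Vcolim F AX i X0).
  rewrite (betti_arr0 hn' Erefl' Vcolim' F' (phiA _ AX) i) //.
  by rewrite X0 limg0.
have AX' := phiA _ AX.
have X0' : (phi @: X)%VS != 0%VS.
  by rewrite -subv0 -(limg0 phi) subphi subv0.
set c := embedding iota X; set c' := embedding iota' _.
pose W := component Vcolim; pose W' := component Vcolim'.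
have WX v : W c v <-> v \in X := component_arr hn Erefl Vcolim F AX X0 v.
have WX' v : W' c' v <-> v \in (phi @: X)%VS :=
  component_arr hn' Erefl' Vcolim' F' AX' X0' v.
pose ys := map W (faces c).
pose ys' := map (preS (phi : {linear V -> V'})) (map W' (faces c')).
have fE v k := @facet_component _ _ hn _ Erefl _ _ Vcolim F X AX X0 k v.
have fE' v k := @facet_component _ _ hn' _ Erefl' _ _ Vcolim' F' _ AX' X0' k v.
have H : koszul_dim W c i%:Z (betti F i c) := betti_koszul_dim hn Erefl Vcolim F i c.
have H' : koszul_dim W' c' i%:Z (betti F' i c') := betti_koszul_dim hn' Erefl' Vcolim' F' i c'.
apply: (qdim_uniq H); rewrite -/(hdim _ _ _ _ _).
have szys : size ys = n by rewrite size_map size_faces.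
have szys' : size ys' = n' by rewrite 2!size_map size_faces.
(* pulled back along phi, the family of V' becomes cofinal with that of V on X *)
rewrite -{1}szys -/ys; apply/(@hdim_cofinal _ _ ys ys').
- move=> y /facesE[k ->]; have [f0|f0] := eqVneq (facet iota X k) 0%VS.
    by left=> v /fE; rewrite f0 memv0 => /eqP.
  right; have Af := facet_arr hn Erefl Vcolim F AX f0.
  have [||l lP] := facet_cofinal hn' Erefl' Vcolim' F' X0' (phiA _ Af).
  + by rewrite subphi capvSl.
  + by rewrite subphi; exact: (facet_proper hn Erefl Vcolim F X0).
  exists (preS (phi : {linear V -> V'}) (W' (c' - dunit l))).
    by apply: List.in_map; apply: mem_faces.
  move=> v /fE; rewrite -memphi => /(subvP lP)/fE'[_]; exact.
- move=> y /List.in_map_iff[y' [<- /facesE[l ->]]].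
  have [f0|f0] := eqVneq (facet iota' (phi @: X)%VS l) 0%VS.
    left=> v [Wv W'v]; have : phi v \in facet iota' (phi @: X)%VS l.
      by apply/fE'; split=> //; apply/WX'; rewrite memphi; apply/WX.
    by rewrite f0 memv0 => /eqP v0; apply: phi_inj; rewrite v0 linear0.
  right; have [Y AY YE] := phiS _ (facet_arr hn' Erefl' Vcolim' F' AX' f0).
  have [||k kP] := facet_cofinal hn Erefl Vcolim F X0 AY.
  + by rewrite -subphi YE capvSl.
  + by rewrite -subphi YE; exact: (facet_proper hn' Erefl' Vcolim' F' X0').
  exists (W (c - dunit k)); first exact: mem_faces.
  move=> v [Wv W'v]; have : v \in facet iota X k; last by case/fE.
  apply: (subvP kP); rewrite -memphi YE; apply/fE'; split=> //.
  by apply/WX'; rewrite memphi; apply/WX.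
rewrite szys'; have : hdim n' ys' (preS (phi : {linear V -> V'}) (W' c')) i%:Z (betti F' i c').
  by apply/hdim_pre.
apply: (fun h1 h2 => proj1 (hdim_ext _ _ _ _ h1 h2)) => v.
  by move=> /WX'; rewrite memphi => /WX.
by move=> /WX vX; apply/WX'; rewrite memphi.
Qed.
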